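(* Let $\lambda>0$ and let $F$ be a probability measure on $\mathbb{R}_+=[0,\infty)$ with $\int r^d F(dr)<\infty$. Consider the thinning which favors small grains, i.e. the weight kernel is $G_r(dw)=\delta_{1/r}(dw)$ for every $r$ (the weight of each grain is the inverse of its radius). Then there exists a constant $c\in(0,\infty)$ such that for all sufficiently large $r$ and all $z\in\mathbb{R}^d$ with $|z|$ sufficiently large, the thinned radius distribution satisfies \[ \bar F_{\rm th}(r)\le\frac{\lambda}{\lambda_{\rm th}}\,e^{-\lambda|B_1|\frac12 r^d}, \] the covariance function of the thinned grain cover satisfies \[ |k_{\rm th}(z)|\le e^{-\lambda|B_1|c|z|^d}, \] and the two-point correlation function of the thinned grain centers satisfies \[ |\xi_{\rm th}(z)|\le e^{-\lambda|B_1|c|z|^d}. \]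
   Context: Notation: $d\ge 1$ is the dimension, $o$ the origin of $\mathbb{R}^d$; $B_r(x)$ is the closed Euclidean ball with center $x$ and radius $r$, $B_r=B_r(o)$; $|B|$ is the Lebesgue measure of a Borel set $B\subset\mathbb{R}^d$, and $|z|$ is the Euclidean norm of a vector $z$. $\mathbb{R}_+=[0,\infty)$. For a probability measure $F$ on $\mathbb{R}_+$, $F(r)=F[0,r]$ and $\bar F(r)=1-F(r)$. Model: $\Phi$ is a Poisson random measure (identified with its random set of points) on $\mathbb{R}^d\times\mathbb{R}_+\times\mathbb{R}_+$ with intensity measure $\lambda\,dx\,F(dr)\,G_r(dw)$, where $\lambda>0$, $\int r^dF(dr)<\infty$ and $G$ is a probability kernel on $\mathbb{R}_+$. A point $(x,r,w)$ is called a grain with center $x$, radius $r$, weight $w$; for the weights $1/r$ one uses the convention $1/0=+\infty$ (weights in $[0,\infty]$), so that $1/r'\ge 1/r$ if and only if $r'\le r$. For a grain configuration $\varphi$, the thinning $T(\varphi)$ is the set of those $(x,r,w)\in\varphi$ such that $w>w'$ for every other grain $(x',r',w')\in\varphi$ with $B_{r'}(x')\cap B_r(x)\ne\emptyset$. The thinned model is $\Phi^{\rm th}=T(\Phi)$, its grain cover is $X^{\rm th}=\bigcup_{(x,r,w)\in\Phi^{\rm th}}B_r(x)$, and $\Phi^{\rm th}_g=\{x:(x,r,w)\in\Phi^{\rm th}\}$ is the point configuration of thinned grain centers. Retention probabilities: $h(r,w)=\mathrm{P}\big((x,r,w)\in T(\Phi\cup\{(x,r,w)\})\big)$ (independent of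 $x$), and $h(r)=\int h(r,w)\,G_r(dw)$. For two reference grains with $|x_1-x_2|=u$, $h_2(u,r_1,w_1,r_2,w_2)=\mathrm{P}\big(\text{both } (x_i,r_i,w_i)\in T(\Phi\cup\{(x_1,r_1,w_1),(x_2,r_2,w_2)\})\big)$, which depends on $x_1,x_2$ only through $u$ (the two reference grains count as different grains), and $h_2(u,r_1,r_2)=\iint h_2(u,r_1,w_1,r_2,w_2)\,G_{r_1}(dw_1)G_{r_2}(dw_2)$. Retention covariance function: $q(u,r_1,r_2)=h_2(u,r_1,r_2)-h(r_1)h(r_2)$. Statistics of the thinned model: density of centers $\lambda_{\rm th}=\lambda\int h(r)F(dr)$; radius distribution of a typical thinned grain $F_{\rm th}(r)=1-\frac{\lambda}{\lambda_{\rm th}}\int_{(r,\infty)}h(s)F(ds)$, with $\bar F_{\rm th}=1-F_{\rm th}$; covariance function $k_{\rm th}(z)=\mathrm{P}(o\in X^{\rm th},z\in X^{\rm th})-\mathrm{P}(o\in X^{\rm th})\mathrm{P}(z\in X^{\rm th})$; two-point correlation function $\xi_{\rm th}$, a function with $\mathrm{Cov}(\Phi^{\rm th}_g(A),\Phi^{\rm th}_g(B))=\lambda_{\rm th}^2\int_A\int_B\xi_{\rm th}(x-y)\,dx\,dy$ for all disjoint bounded measurable $A,B\subset\mathbb{R}^d$, taken in the version $\xi_{\rm th}(z)=\frac{\lambda^2}{\lambda_{\rm th}^2}\iint q(|z|,r_1,r_2)F(dr_1)F(dr_2)$. *)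

(* Defs.v *)
From HB Require Import structures.
From mathcomp Require Import all_boot all_order all_algebra.
From mathcomp Require Import all_classical all_reals all_analysis.
From mathcomp Require Import measurable_realfun.

Set Implicit Arguments.
Unset Strict Implicit.
Unset Printing Implicit Defensive.
Import Order.TTheory GRing.Theory Num.Theory.
Import numFieldNormedType.Exports.

Local Open Scope classical_set_scope.
Local Open Scope ring_scope.

(* MathComp-Analysis has a product sigma-algebra on tuples but no Lebesgue
   measure on R^d; it is built here from the one-dimensional one by iterating
   the binary product along (x, y) |-> x :: y. *)
Section lebesgue_measure_Rd.
Context {R : realType}.

Definition tcons d (p : measurableTypeR R * d.-tuple R) : d.+1.-tuple R :=
  [tuple of (p.1 : R) :: p.2].

Lemma measurable_tcons d : measurable_fun setT (@tcons d).
Proof.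
exact: (@measurable_cons _ _ _ R (fst : _ -> R)).
Qed.

Let tuncons d (t : d.+1.-tuple R) : measurableTypeR R * d.-tuple R :=
  (thead t, [tuple of behead t]).

Let measurable_tuncons d : measurable_fun setT (@tuncons d).
Proof.
apply/measurable_fun_pair; last exact: measurable_behead.
exact: (@measurable_tnth _ R d.+1 ord0).
Qed.

Let tconsK d : cancel (@tcons d) (@tuncons d).
Proof. by case=> x t; congr pair; apply/val_inj. Qed.

Section step.
Variables (d : nat) (mu : {sigma_finite_measure set (d.-tuple R) -> \bar R}).

Definition lebesgue_step : set (d.+1.-tuple R) -> \bar R :=
  pushforward (lebesgue_measure \x mu)%E (@tcons d).

Let m0 : lebesgue_step set0 = 0%E.
Proof. by rewrite /lebesgue_step /pushforward preimage_set0 measure0. Qed.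

Let mge0 A : (0 <= lebesgue_step A)%E.
Proof. by rewrite /lebesgue_step /pushforward measure_ge0. Qed.

Let msigma : semi_sigma_additive lebesgue_step.
Proof.
move=> F mF tF mUF; rewrite /lebesgue_step /pushforward preimage_bigcup.
have mp (A : set (d.+1.-tuple R)) : measurable A -> measurable (@tcons d @^-1` A).
  by move=> mA; rewrite -[X in measurable X]setTI; exact: measurable_tcons.
apply: measure_semi_sigma_additive => //; first by move=> n; exact: mp.
- apply/trivIsetP => /= i j _ _ ij; rewrite -preimage_setI.
  by move/trivIsetP : tF => /(_ _ _ _ _ ij) ->//; rewrite preimage_set0.
- by rewrite -preimage_bigcup; exact: mp.
Qed.

HB.instance Definition _ := isMeasure.Build _ _ _ lebesgue_step m0 mge0 msigma.

Let msf : sigma_finite setT lebesgue_step.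
Proof.
have /sigma_finiteP[F [TF ndF Foo]] := sigma_finiteT (@lebesgue_measure R).
have /sigma_finiteP[G [TG ndG Goo]] := sigma_finiteT mu.
exists (fun n => @tuncons d @^-1` (F n `*` G n)).
  rewrite -preimage_bigcup (_ : \bigcup_i _ = setT) ?preimage_setT//.
  apply/seteqP; split=> // -[x y] _.
  have [n _ Fnx] : (\bigcup_i F i) x by rewrite -TF.
  have [k _ Gky] : (\bigcup_i G i) y by rewrite -TG.
  exists (maxn n k) => //; split.
  - by move: x Fnx; exact/subsetPset/ndF/leq_maxl.
  - by move: y Gky; exact/subsetPset/ndG/leq_maxr.
move=> n; have [? ?] := Foo n; have [? ?] := Goo n; split.
  by rewrite -[X in measurable X]setTI; apply: measurable_tuncons => //;
    exact: measurableX.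
rewrite /lebesgue_step /pushforward -comp_preimage.
rewrite (_ : _ \o _ = id) ?preimage_id; last first.
  by apply/funext => x /=; rewrite tconsK.
by rewrite product_measure1E// lte_mul_pinfty// ge0_fin_numE.
Qed.

HB.instance Definition _ := Measure_isSigmaFinite.Build _ _ _ lebesgue_step msf.

End step.

Fixpoint lebesgue_Rd d : {sigma_finite_measure set (d.-tuple R) -> \bar R} :=
  match d with
  | 0 => \d_[tuple]
  | d'.+1 => lebesgue_step (lebesgue_Rd d')
  end.

End lebesgue_measure_Rd.

Section euclidean_space.
Context {R : realType}.

Definition origin d : d.-tuple R := [tuple 0 | _ < d].

(* u e_1, a point of norm |u| as soon as d >= 1 *)
Definition on_axis d (u : R) : d.-tuple R :=
  [tuple if (i : nat) == 0%N then u else 0 | i < d].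

Definition enorm d (x : d.-tuple R) : R := Num.sqrt (\sum_(i < d) tnth x i ^+ 2).

Definition edist d (x y : d.-tuple R) : R :=
  Num.sqrt (\sum_(i < d) (tnth x i - tnth y i) ^+ 2).

Definition cball d (x : d.-tuple R) (r : R) : set (d.-tuple R) :=
  [set y | edist x y <= r].

Definition unit_ball_volume d : R := fine (lebesgue_Rd d (cball (origin d) 1)).

End euclidean_space.

Section poisson_random_measure.
Context {R : realType} {dO dT : measure_display} {Omega : measurableType dO}
  {T : measurableType dT}.

Definition npoints (Phi : Omega -> set T) (B : set T) (omega : Omega) : \bar R :=
  counting (Phi omega `&` B).

(* Phi is a random set of points whose counting measure is a Poisson random
   measure with intensity Lambda.  Points carry no multiplicity, which loses
   nothing for the diffuse intensities considered below. *)
Record is_poisson (P : probability Omega R) (Phi : Omega -> set T)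
    (Lambda : set T -> \bar R) : Prop := IsPoisson {
  npoints_measurable : forall B, measurable B ->
    measurable_fun setT (npoints Phi B);
  npoints_poisson : forall B, measurable B -> (Lambda B < +oo)%E ->
    forall n : nat, P (npoints Phi B @^-1` [set n%:R%:E]) =
      (fine (Lambda B) ^+ n / n`!%:R * expR (- fine (Lambda B)))%:E;
  npoints_infinite : forall B, measurable B -> Lambda B = +oo%E ->
    P (npoints Phi B @^-1` [set +oo%E]) = 1%E;
  npoints_independent : forall (n : nat) (B : 'I_n -> set T),
    (forall i, measurable (B i)) -> trivIset setT B ->
    forall A : 'I_n -> set (\bar R), (forall i, measurable (A i)) ->
    P (\bigcap_i (npoints Phi (B i) @^-1` A i)) =
      (\prod_(i < n) P (npoints Phi (B i) @^-1` A i))%E }.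

End poisson_random_measure.

(* A grain is (center, radius, weight).  Radii and weights are taken in R and
   \bar R; [is_grain_process] and the support of the radius distribution confine
   them to [0, +oo[ and [0, +oo]. *)
Notation grain R d := (d.-tuple R * R * \bar R)%type.

Section germ_grain_model.
Context {R : realType} {d : nat}.
Implicit Types (g : grain R d) (phi : set (grain R d)).

Definition center g : d.-tuple R := g.1.1.
Definition radius g : R := g.1.2.
Definition weight g : \bar R := g.2.
Definition body g : set (d.-tuple R) := cball (center g) (radius g).

Definition thin phi : set (grain R d) :=
  [set g | phi g /\ forall g', phi g' -> g' <> g ->
    body g' `&` body g !=set0 -> (weight g' < weight g)%E].

Definition cover phi : set (d.-tuple R) := \bigcup_(g in phi) body g.

(* lambda dx F(dr) G_r(dw) *)
Definition grain_intensity (lambda : R) (F : probability R R)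
    (G : R.-pker R ~> \bar R) (B : set (grain R d)) : \bar R :=
  (lambda%:E * \int[lebesgue_Rd d]_x \int[F]_r G r [set w | B (x, r, w)])%E.

Context {dO : measure_display} {Omega : measurableType dO}.

(* The intensity gives finite mass to the grains with center in a bounded set,
   so such grains are finitely many almost surely; as usual for point processes,
   the realizations are taken to be locally finite everywhere on Omega. *)
Record is_grain_process (P : probability Omega R) (lambda : R)
    (F : probability R R) (G : R.-pker R ~> \bar R)
    (Phi : Omega -> set (grain R d)) : Prop := IsGrainProcess {
  grain_nonneg : forall omega g, Phi omega g ->
    0 <= radius g /\ (0 <= weight g)%E;
  grain_locally_finite : forall omega (rho : R),
    finite_set (Phi omega `&` [set g | enorm (center g) <= rho]);
  grain_poisson : is_poisson P Phi (grain_intensity lambda F G) }.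

Variables (P : probability Omega R) (lambda : R) (F : probability R R)
  (G : R.-pker R ~> \bar R) (Phi : Omega -> set (grain R d)).

Definition Phi_th (omega : Omega) : set (grain R d) := thin (Phi omega).

Definition X_th (omega : Omega) : set (d.-tuple R) := cover (Phi_th omega).

(* By stationarity the reference grain may be centered at the origin. *)
Definition retention_w (r : R) (w : \bar R) : R :=
  let g := (origin d, r, w) in
  fine (P [set omega | thin (Phi omega `|` [set g]) g]).

Definition retention (r : R) : R := \int[G r]_w retention_w r w.

(* By stationarity and isotropy the reference grains may be centered at the
   origin and at u e_1.  Two reference grains with equal center, radius and
   weight would be merged in the union although they count as different grains;
   they would meet with equal weights, so neither would be retained: hence the
   conjunct g1 <> g2. *)
Definition retention2_w (u r1 : R) (w1 : \bar R) (r2 : R) (w2 : \bar R) : R :=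
  let g1 := (origin d, r1, w1) in
  let g2 := (on_axis d u, r2, w2) in
  fine (P [set omega | let phi := Phi omega `|` [set g1; g2] in
    [/\ g1 <> g2, thin phi g1 & thin phi g2]]).

Definition retention2 (u r1 r2 : R) : R :=
  \int[G r1]_w1 \int[G r2]_w2 retention2_w u r1 w1 r2 w2.

Definition retention_cov (u r1 r2 : R) : R :=
  retention2 u r1 r2 - retention r1 * retention r2.

Definition lambda_th : R := lambda * \int[F]_r retention r.

Definition F_th (r : R) : R :=
  1 - lambda / lambda_th * \int[F]_(s in `]r, +oo[) retention s.

Definition Fbar_th (r : R) : R := 1 - F_th r.

Definition k_th (z : d.-tuple R) : R :=
  fine (P [set omega | X_th omega (origin d) /\ X_th omega z]) -
  fine (P [set omega | X_th omega (origin d)]) *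
  fine (P [set omega | X_th omega z]).

Definition xi_th (z : d.-tuple R) : R :=
  lambda ^+ 2 / lambda_th ^+ 2 *
  \int[F]_r1 \int[F]_r2 retention_cov (enorm z) r1 r2.

End germ_grain_model.

Section favor_small_grains.
Context {R : realType}.

(* In \bar R, 0^-1 = +oo. *)
Definition inverse_radius (r : R) : \bar R := (r%:E^-1)%E.

Lemma measurable_inverse_radius : measurable_fun setT inverse_radius.
Proof.
have -> : inverse_radius = fun r => if r == 0 then +oo%E else (r^-1)%:E.
  by apply/funext => r; rewrite /inverse_radius inver.
apply: measurable_fun_if => //.
- exact: measurable_fun_eqr.
- apply/measurable_EFinP.
  have m : measurable_fun [set~ 0 : R] (@GRing.inv R).
    apply: open_continuous_measurable_fun.
    + exact/closed_openC/closed_eq.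
    + by move=> r /[!inE] /= r0; apply: inv_continuous; exact/eqP.
  apply: measurable_funS m => //.
  + by apply: measurableC; exact: measurable_set1.
  + by move=> r [_ /= r0] /= r1; rewrite r1 eqxx in r0.
Qed.

Definition favor_small_kernel : R.-pker R ~> \bar R :=
  kdirac measurable_inverse_radius.

End favor_small_grains.

(* Main.v *)
Require Import Defs.
From HB Require Import structures.
From mathcomp Require Import all_boot all_order all_algebra.
From mathcomp Require Import all_classical all_reals all_analysis.
From mathcomp Require Import measurable_realfun ring lra.

Set Implicit Arguments.
Unset Strict Implicit.
Unset Printing Implicit Defensive.

Import Order.TTheory GRing.Theory Num.Theory.
Import numFieldNormedType.Exports.
(* After the libraries, so that [edist] is the Euclidean distance. *)
Import Defs.

Local Open Scope classical_set_scope.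
Local Open Scope ring_scope.

(** All events are reduced to void events: the events that a given set of grains
    contains no point of the process.  A void event has an explicit probability,
    and void events of disjoint sets are independent.

    Retention.  A grain is retained when no other grain is among its killers, so
    retention probabilities are void probabilities.  With inverse radii as
    weights, every grain of radius smaller than [t] centered in the body of a
    grain of radius [s >= t] is a killer of it; these grains have intensity
    [lambda |B_t| F[0,t[] or more, and [F[0,t[ >= 1/2] for large [t].  Hence
    [h(s) <= exp(- lambda |B_1| t^d / 2)] for [s >= t] ([retention_le]), and
    integrating over [s > r] with [t = r] gives the bound on the radius
    distribution ([Fbar_th_le]).

    Two-point correlation.  If both radii are at most [t] and the centers are
    more than [4 t] apart, the two reference grains have no common killer, since
    a killer meets its victim and is not larger; independence of the process on
    disjoint sets then makes the retention covariance zero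
    ([retention_cov_far]).  If one radius exceeds [t], the covariance is bounded
    by the retention probability of that grain ([retention_cov_le]).  Take [t]
    proportional to [|z|].

    Cover.  By the same locality, whether [z] is covered by a retained grain of
    radius at most [t] only depends on grains centered within [3 t] of [z].  A
    retained grain of radius larger than [t] that contains [z] contains a ball
    of radius [t / 2] taken from a finite family depending on [z] and [t] only,
    and that ball contains no center of a grain smaller than [t]: an event of
    probability at most a constant times, for large [t],
    [exp(- lambda |B_1| (t/2)^d / 2)] ([bad_prob_le]).  Outside of this event the
    cover at [z] coincides with its local version ([locally_coveredP]), and the
    local versions at two points more than [6 t] apart are independent
    ([k_th_le]).

    Measurability.  The cover event must be measurable on the nose, for a
    process that is only observed through the numbers of its points in
    measurable sets.  The condition that a grain does not remove another one is
    a countable union of measurable rectangles ([rectangular_spares]), which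
    expresses the survival of some grain in a bounded window by countably many
    void events in that window ([g_survivor]).  The same description, with the
    pi-system of void events, yields the independence of local events
    ([independent_windows]). *)

(** * Integrals of arbitrary functions *)

Section integrals.
Context {dT : measure_display} {T : measurableType dT} {R : realType}.
Import HBNNSimple.

(** The integral of a nonnegative function is by definition a supremum over the
    simple functions below it, hence monotone on all nonnegative functions.
    Pointwise bounds on retention probabilities thus pass to their integrals
    before anything is known of how they vary with radii and weights. *)
Lemma ge0_integral_mono (mu : {measure set T -> \bar R}) (D : set T)
    (f g : T -> \bar R) :
  (forall x, D x -> (0 <= f x)%E) -> (forall x, D x -> (f x <= g x)%E) ->
  (\int[mu]_(x in D) f x <= \int[mu]_(x in D) g x)%E.
Proof.
move=> f0 fg; rewrite !ge0_integralE//; last first.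
  by move=> x Dx; exact: le_trans (f0 x Dx) (fg x Dx).
apply: ereal_sup_le => _ /= [h hf <-]; exists h => // x.
apply: le_trans (hf x) _; rewrite /patch; case: ifPn => // /set_mem.
exact: fg.
Qed.

Lemma normr_Rintegral_le (mu : probability T R) (D : set T) (f : T -> R) (M : R) :
  measurable D -> 0 <= M -> (forall x, D x -> `|f x| <= M) ->
  `|\int[mu]_(x in D) f x| <= M.
Proof.
move=> mD M0 fM.
have bound (g : T -> \bar R) : (forall x, D x -> (0 <= g x <= M%:E)%E) ->
    (0 <= \int[mu]_(x in D) g x <= M%:E)%E.
  move=> gM; rewrite integral_ge0 /=; last by move=> x /gM /andP[].
  have /le_trans -> // : (\int[mu]_(x in D) g x <= \int[mu]_(x in D) cst M%:E x)%E.
    by apply: ge0_integral_mono => x /gM /andP[].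
  by rewrite integral_cst//= -[leRHS]mule1 lee_pmul // probability_le1.
have fp x : D x -> (0 <= (EFin \o f)^\+ x <= M%:E)%E.
  move=> /fM; rewrite ler_norml => /andP[_ fM'].
  by rewrite funepos_ge0 /= unlock ge_max !lee_fin fM' M0.
have fn x : D x -> (0 <= (EFin \o f)^\- x <= M%:E)%E.
  move=> /fM; rewrite ler_norml => /andP[fM' _].
  by rewrite funeneg_ge0 /= unlock ge_max !lee_fin lerNl fM' M0.
move: {fp fn} (bound _ fp) (bound _ fn); rewrite /Rintegral integralE.
move=> /andP[p0 pM] /andP[n0 nM].
have fin y : (0 <= y)%E -> (y <= M%:E)%E -> exists2 a : R, y = a%:E & 0 <= a <= M.
  by case: y => [a| |] //; rewrite !lee_fin => a0 aM; exists a => //; apply/andP.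
have [a -> /andP[a0 aM]] := fin _ p0 pM.
have [b -> /andP[b0 bM]] := fin _ n0 nM => /=.
by rewrite ler_norml; apply/andP; split; lra.
Qed.

(** [f] is squeezed between two measurable functions with the same value at
    the atom: one vanishes and the other is infinite elsewhere. *)
Lemma ge0_Rintegral_dirac (a : T) (f : T -> R) :
  measurable [set a] -> (forall x, 0 <= f x) ->
  \int[\d_a]_x f x = f a.
Proof.
move=> ma f0; rewrite /Rintegral; suff -> : (\int[\d_a]_x (f x)%:E)%E = (f a)%:E by [].
have ind y : (\int[\d_a]_x (if x \in [set a] then (f a)%:E else y))%E = (f a)%:E.
  rewrite integral_dirac//=; first by rewrite diracT mul1e mem_set.
  by apply: measurable_fun_ifT => //; apply: measurable_fun_bool; rewrite setTI
    (_ : _ @^-1` _ = [set a])//; apply/seteqP; split => x /= => [/set_mem|/mem_set].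
apply/eqP; rewrite eq_le; apply/andP; split.
  rewrite -(ind +oo%E); apply: ge0_integral_mono => x _; first by rewrite lee_fin.
  by case: ifPn => [/[!inE] /= ->//|_]; exact: leey.
rewrite -(ind 0%E); apply: ge0_integral_mono => x _.
  by case: ifPn => _; rewrite lee_fin.
by case: ifPn => [/[!inE] /= ->//|_]; rewrite lee_fin.
Qed.

End integrals.

(** * Lebesgue measure on R^d *)

Section volume.
Context {R : realType}.

Definition affine d (a : d.-tuple R) (s : R) (x : d.-tuple R) : d.-tuple R :=
  [tuple tnth a i + s * tnth x i | i < d].

Lemma measurable_affine d (a : d.-tuple R) s : measurable_fun setT (affine a s).
Proof.
apply/measurable_fun_tnthP => i.
rewrite (_ : _ \o _ = fun x => tnth a i + s * tnth x i); last first.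
  by apply/funext => x /=; rewrite tnth_mktuple.
by apply: measurable_funD => //; apply: measurable_funM => //; exact: measurable_tnth.
Qed.

Lemma lebesgue_measure_affine (a s : R) (A : set (measurableTypeR R)) :
  0 < s -> measurable A ->
  lebesgue_measure A = (s%:E * lebesgue_measure ((fun x => (a + s * x)%R) @^-1` A))%E.
Proof.
move=> s0 mA.
pose f := fun x : measurableTypeR R => (a + s * x)%R : measurableTypeR R.
have mf : measurable_fun setT f.
  by apply: measurable_funD => //; exact: measurable_funM.
pose mu : {measure set (measurableTypeR R) -> \bar R} :=
  mscale (NngNum (ltW s0)) (pushforward lebesgue_measure f).
rewrite (@lebesgue_measure_unique _ (mu mf))// => _ [[x y] _ <-] /=.
rewrite /mu /= /mscale /= /pushforward.
rewrite (_ : _ @^-1` _ = `](x - a) / s, (y - a) / s]%classic); last first.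
  apply/seteqP; split => z /=; rewrite !in_itv /= ltr_pdivrMr// ler_pdivlMr// /f;
    by move=> /andP[? ?]; apply/andP; split; lra.
rewrite !lebesgue_measure_itv /= !lte_fin ltr_pM2r ?invr_gt0// ltrD2r.
case: ifPn => _; last by rewrite mule0.
by rewrite -!EFinB -EFinM; congr EFin; field; rewrite gt_eqF.
Qed.


(** Translations and dilations at once.  The image of a product measure is a
    product measure, so uniqueness of the latter reduces the claim to one
    coordinate. *)
Lemma lebesgue_Rd_affine d (a : d.-tuple R) (s : R) (A : set (d.-tuple R)) :
  0 < s -> measurable A ->
  lebesgue_Rd d A = ((s ^+ d)%:E * lebesgue_Rd d (affine a s @^-1` A))%E.
Proof.
move=> s0; elim: d => [|d IH] in a A *.
  move=> _; rewrite expr0 mul1e (_ : _ @^-1` A = A)//.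
  by apply/seteqP; split => x /=; rewrite [affine _ _ _]tuple0 [x]tuple0.
move=> mA.
pose f1 := fun x : measurableTypeR R => (thead a + s * x)%R : measurableTypeR R.
pose f2 := affine [tuple of behead a] s.
pose f := fun p : measurableTypeR R * d.-tuple R => (f1 p.1, f2 p.2).
have mf1 : measurable_fun setT f1.
  by apply: measurable_funD => //; exact: measurable_funM.
have mf : measurable_fun setT f.
  apply/measurable_fun_pair; first exact: measurableT_comp.
  by apply: measurableT_comp => //; exact: measurable_affine.
have affineE p : affine a s (tcons p) = tcons (f p).
  apply/eq_from_tnth => i; rewrite tnth_mktuple.
  have [j ->|->] := unliftP ord0 i; last by rewrite !tnth0.
  rewrite !tnthS /f2 tnth_mktuple; congr (_ + _).
  by rewrite !(tnth_nth 0) /= nth_behead.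
pose mu : {measure set (measurableTypeR R * d.-tuple R) -> \bar R} :=
  mscale (NngNum (exprn_ge0 d.+1 (ltW s0)))
    (pushforward (lebesgue_measure \x lebesgue_Rd d)%E f).
have mtA : measurable (@tcons R d @^-1` A).
  by rewrite -[X in measurable X]setTI; exact: measurable_tcons.
rewrite /= /lebesgue_step /pushforward (@product_measure_unique _ _ _ _ _ _ _ (mu mf))//.
  rewrite /mu /= /mscale /pushforward /=; congr (_ * product_measure1 _ _ _)%E.
  by apply/seteqP; split => p; rewrite /preimage /= affineE.
move=> B C mB mC.
have -> : mu mf (B `*` C) = ((s ^+ d.+1)%:E *
    (lebesgue_measure \x lebesgue_Rd d) ((f1 @^-1` B) `*` (f2 @^-1` C)))%E by [].
rewrite product_measure1E//; last 2 first.
  by rewrite -[X in measurable X]setTI; exact: mf1.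
  by rewrite -[X in measurable X]setTI; exact: measurable_affine.
rewrite [X in _ = (X * _)%E](lebesgue_measure_affine (thead a) s0 mB) (IH [tuple of behead a] C mC).
by rewrite exprS EFinM muleACA.
Qed.


Lemma edist_affine d (a : d.-tuple R) (s : R) x y :
  0 <= s -> edist (affine a s x) (affine a s y) = s * edist x y.
Proof.
move=> s0; rewrite /edist -[X in X * _](ger0_norm s0) -sqrtr_sqr -sqrtrM ?sqr_ge0//.
by congr Num.sqrt; rewrite mulr_sumr; apply: eq_bigr => i _;
  rewrite !tnth_mktuple; ring.
Qed.

Lemma affine_origin d (a : d.-tuple R) s : affine a s (origin d) = a.
Proof. by apply/eq_from_tnth => i; rewrite !tnth_mktuple mulr0 addr0. Qed.

Lemma measurable_edist d (q : d.-tuple R) : measurable_fun setT (edist q).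
Proof.
apply: (@measurableT_comp _ _ _ _ _ _ (@Num.sqrt R)) => /=.
  by apply: continuous_measurable_fun => x; exact: sqrt_continuous.
apply: measurable_sum => i; apply: measurable_funX.
by apply: measurable_funB => //; exact: measurable_tnth.
Qed.

Lemma measurable_cball d (q : d.-tuple R) r : measurable (cball q r).
Proof.
rewrite -[X in measurable X]setTI; apply: measurable_fun_le => //.
exact: measurable_edist.
Qed.

Definition cube d (a : R) : set (d.-tuple R) :=
  [set x | forall i, `|tnth x i| <= a].
Arguments cube : clear implicits.

Lemma measurable_cube d a : measurable (cube d a).
Proof.
rewrite (_ : cube d a = \bigcap_(i in [set: 'I_d]) [set x | `|tnth x i| <= a]).
  apply: fin_bigcap_measurable => // i _.
  rewrite -[X in measurable X]setTI; apply: measurable_fun_le => //.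
  by apply: measurableT_comp => //; exact: measurable_tnth.
by apply/seteqP; split => [x xa i _|x xa i] //=; exact: xa.
Qed.

Lemma lebesgue_Rd_cube d a : 0 <= a -> lebesgue_Rd d (cube d a) = ((2 * a) ^+ d)%:E.
Proof.
move=> a0; elim: d => [|d IH].
  by rewrite expr0 /= diracE mem_set// => -[].
rewrite /= /lebesgue_step /pushforward.
rewrite (_ : _ @^-1` _ = `[- a, a]%classic `*` cube d a).
  rewrite product_measure1E//; last exact: measurable_cube.
  rewrite [X in (_ * X)%E = _]IH exprS EFinM; congr (_ * _)%E.
  rewrite [LHS](lebesgue_measure_itv `[- a, a]) /= lte_fin; case: ifPn => [_|].
    by rewrite -EFinB; congr EFin; ring.
  by rewrite -leNgt => ?; congr EFin; lra.
apply/seteqP; split => -[x t] /=.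
  move=> h; split => /=; first by have := h ord0; rewrite tnth0 ler_norml in_itv.
  by move=> i; have := h (lift ord0 i); rewrite tnthS.
rewrite in_itv /= -ler_norml => -[xa ta] i.
by have [j ->|->] := unliftP ord0 i; rewrite ?tnthS ?tnth0//; exact: ta.
Qed.

Lemma cball_sub_cube d (r : R) : cball (origin d) r `<=` cube d r.
Proof.
move=> x /= xr i; apply: le_trans xr.
rewrite -(ler_sqr) ?nnegrE ?sqrtr_ge0// sqr_sqrtr ?sumr_ge0//; last first.
  by move=> j _; exact: sqr_ge0.
rewrite (bigD1 i)//= tnth_mktuple sub0r sqrrN real_normK ?num_real// lerDl.
by rewrite sumr_ge0// => j _; exact: sqr_ge0.
Qed.

Lemma cube_sub_cball d : cube d d.+1%:R^-1 `<=` cball (origin d) 1.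
Proof.
move=> x xd; rewrite /cball /= /edist -sqrtr1 ler_sqrt//.
apply: (@le_trans _ _ (\sum_(i < d) d.+1%:R^-1)).
  apply: ler_sum => i _; rewrite tnth_mktuple sub0r sqrrN.
  rewrite -real_normK ?num_real// expr2; apply: le_trans (xd i).
  rewrite ler_piMl//; apply: le_trans (xd i) _.
  by rewrite invf_le1// ler1n.
rewrite sumr_const card_ord -[leLHS]mulr_natl ler_pdivrMr// mul1r ler_nat.
exact: leqnSn.
Qed.

Lemma unit_ball_volumeE d :
  lebesgue_Rd d (cball (origin d) 1) = (unit_ball_volume d)%:E :> \bar R.
Proof.
rewrite fineK// ge0_fin_numE//; apply: le_lt_trans (ltry ((2 * 1) ^+ d)).
rewrite -(lebesgue_Rd_cube _ ler01); apply: le_measure; rewrite ?inE.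
- exact: measurable_cball.
- exact: measurable_cube.
- exact: cball_sub_cube.
Qed.

Lemma unit_ball_volume_gt0 d : 0 < unit_ball_volume d :> R.
Proof.
rewrite -lte_fin -unit_ball_volumeE.
have c0 : 0 <= d.+1%:R^-1 :> R by rewrite invr_ge0.
apply: (@lt_le_trans _ _ (lebesgue_Rd d (cube d d.+1%:R^-1))).
  by rewrite lebesgue_Rd_cube// lte_fin exprn_gt0// mulr_gt0// invr_gt0.
apply: le_measure; rewrite ?inE.
- exact: measurable_cube.
- exact: measurable_cball.
- exact: cube_sub_cball.
Qed.

Lemma lebesgue_Rd_cball d (y : d.-tuple R) (r : R) : 0 < r ->
  lebesgue_Rd d (cball y r) = (r ^+ d * unit_ball_volume d)%:E.
Proof.
move=> r0; rewrite (lebesgue_Rd_affine y r0 (measurable_cball _ _)) EFinM.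
rewrite -unit_ball_volumeE; congr (_ * lebesgue_Rd d _)%E.
apply/seteqP; split => x; rewrite /cball /preimage /=
  -[X in edist X (affine _ _ _)](affine_origin y r) (edist_affine _ _ _ (ltW r0));
by rewrite -(ler_pM2l r0 _ 1) mulr1.
Qed.

Lemma ge0_integral_translation d (a : d.-tuple R) (f : d.-tuple R -> \bar R) :
  measurable_fun setT f -> (forall x, (0 <= f x)%E) ->
  (\int[lebesgue_Rd d]_x f (affine a 1 x) = \int[lebesgue_Rd d]_x f x)%E.
Proof.
move=> mf f0; have ma := measurable_affine a 1.
rewrite [RHS](@eq_measure_integral _ _ _ _ (pushforward (lebesgue_Rd d) (affine a 1))).
  by rewrite (ge0_integral_pushforward ma).
move=> A mA _; apply: (etrans (lebesgue_Rd_affine a ltr01 mA)).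
by rewrite expr1n mul1e.
Qed.

End volume.

(** * Euclidean geometry *)

Section geometry.
Context {R : realType} {d : nat}.
Implicit Types x y z : d.-tuple R.

Lemma edist_ge0 x y : 0 <= edist x y.
Proof. exact: sqrtr_ge0. Qed.

Lemma edistC x y : edist x y = edist y x.
Proof. by congr Num.sqrt; apply: eq_bigr => i _; rewrite -sqrrN opprB. Qed.

Lemma edistxx x : edist x x = 0.
Proof.
by rewrite /edist big1 ?sqrtr0// => i _; rewrite subrr expr0n.
Qed.

Lemma enormE x : enorm x = edist (origin d) x.
Proof.
by congr Num.sqrt; apply: eq_bigr => i _; rewrite tnth_mktuple sub0r sqrrN.
Qed.

Lemma enorm_on_axis (u : R) : (0 < d)%N -> enorm (on_axis d u) = `|u|.
Proof.
move=> d0; rewrite -sqrtr_sqr; congr Num.sqrt.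
rewrite (bigD1 (Ordinal d0))//= tnth_mktuple /= big1 ?addr0// => i.
rewrite -val_eqE /= => /negbTE i0.
by rewrite tnth_mktuple i0 expr0n.
Qed.

Lemma minkowski_sum (a b : 'I_d -> R) :
  Num.sqrt (\sum_i (a i + b i) ^+ 2) <=
  Num.sqrt (\sum_i a i ^+ 2) + Num.sqrt (\sum_i b i ^+ 2).
Proof.
set A := \sum_i a i ^+ 2; set B := \sum_i b i ^+ 2.
pose C := \sum_i a i * b i.
have A0 : 0 <= A by apply: sumr_ge0 => i _; exact: sqr_ge0.
have B0 : 0 <= B by apply: sumr_ge0 => i _; exact: sqr_ge0.
have lin s t : \sum_i (s * a i + t * b i) ^+ 2 = s ^+ 2 * A + 2 * s * t * C + t ^+ 2 * B.
  rewrite !mulr_sumr -!big_split /=; apply: eq_bigr => i _; ring.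
have pos s t : 0 <= s ^+ 2 * A + 2 * s * t * C + t ^+ 2 * B.
  by rewrite -lin; apply: sumr_ge0 => i _; exact: sqr_ge0.
have := sqr_sqrtr A0; have := sqr_sqrtr B0.
have := sqrtr_ge0 A; have := sqrtr_ge0 B.
set p := Num.sqrt A; set q := Num.sqrt B => q0 p0 qB pA.
have Cpq : C <= p * q.
  move: p0; rewrite le_eqVlt => /predU1P[p0|p0].
    rewrite -p0 mul0r leNgt; apply/negP => C0.
    (* As A = 0, the quadratic form takes here the value - 4 C^2. *)
    have := pos (- (B + 1)) (2 * C); rewrite -pA -p0 expr0n /= mulr0 add0r.
    by apply/negP; rewrite -ltNge; nra.
  move: q0; rewrite le_eqVlt => /predU1P[q0|q0].
    rewrite -q0 mulr0 leNgt; apply/negP => C0.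
    have := pos (2 * C) (- (A + 1)); rewrite -qB -q0 expr0n /= mulr0 addr0.
    by apply/negP; rewrite -ltNge; nra.
  (* The optimal combination; its form equals 2 p q (p q - C). *)
  have := pos q (- p); rewrite -pA -qB => h.
  have pq0 : 0 < p * q by exact: mulr_gt0.
  by rewrite -(ler_pM2l pq0); nra.
rewrite -(ler_sqr) ?nnegrE ?sqrtr_ge0 ?addr_ge0//.
have -> : \sum_i (a i + b i) ^+ 2 = A + 2 * C + B.
  by have := lin 1 1; under eq_bigr do rewrite !mul1r; move=> ->; ring.
rewrite sqr_sqrtr; first by rewrite (_ : (p + q) ^+ 2 = A + 2 * (p * q) + B); [lra|rewrite -pA -qB; ring].
by have := pos 1 1; rewrite !expr1n !mul1r !mulr1.
Qed.

Lemma edist_triangle x y z : edist x z <= edist x y + edist y z.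
Proof.
rewrite /edist; have := minkowski_sum (fun i => tnth x i - tnth y i) (fun i => tnth y i - tnth z i).
by under [X in Num.sqrt X <= _ -> _]eq_bigr do rewrite addrA subrK.
Qed.

Lemma edist_le_coord x y e : 0 <= e ->
  (forall i, `|tnth x i - tnth y i| <= e / d.+1%:R) -> edist x y <= e.
Proof.
move=> e0 xy; rewrite -[leRHS](ger0_norm e0) -sqrtr_sqr ler_wsqrtr//.
apply: (@le_trans _ _ (\sum_(i < d) (e / d.+1%:R) ^+ 2)).
  by apply: ler_sum => i _; rewrite -real_normK ?num_real// lerXn2r ?nnegrE// divr_ge0.
rewrite sumr_const card_ord -[leLHS]mulr_natl expr_div_n mulrCA ler_piMr ?sqr_ge0//.
rewrite -exprVn expr2 mulrA; apply: mulr_ile1.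
- by rewrite divr_ge0.
- by rewrite invr_ge0.
- by rewrite ler_pdivrMr// mul1r ler_nat.
- by rewrite invf_le1// ler1n.
Qed.

(** The segment between the centers provides a common point. *)
Lemma cball_meetP x r y s : 0 <= r -> 0 <= s ->
  (cball x r `&` cball y s !=set0) <-> edist x y <= r + s.
Proof.
move=> r0 s0; split.
  move=> [z [xz yz]]; apply: le_trans (edist_triangle x z y) _.
  by rewrite lerD// edistC.
move=> xy; pose t := r / (r + s).
have [rs0|] := ltP 0 (r + s); last first.
  move=> rs; exists x; rewrite /cball /=; split; first by rewrite edistxx.
  by rewrite edistC; lra.
have t0 : 0 <= t by rewrite divr_ge0// ltW.
have t1 : t <= 1 by rewrite ler_pdivrMr// mul1r lerDl.
have rE : t * (r + s) = r by rewrite divfK// gt_eqF.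
pose z : d.-tuple R := [tuple tnth x i + t * (tnth y i - tnth x i) | i < d].
have dist (u : R) (w : d.-tuple R) : 0 <= u ->
    (forall i, (tnth w i - tnth z i) ^+ 2 = u ^+ 2 * (tnth x i - tnth y i) ^+ 2) ->
    edist w z = u * edist x y.
  move=> u0 wz; rewrite /edist -[X in X * _](ger0_norm u0) -sqrtr_sqr -sqrtrM ?sqr_ge0//.
  by congr Num.sqrt; rewrite mulr_sumr; exact: eq_bigr.
exists z; rewrite /cball /=; split.
  rewrite (dist t)//; last by move=> i; rewrite tnth_mktuple; ring.
  by rewrite -[leRHS]rE ler_wpM2l.
rewrite (dist (1 - t)) ?subr_ge0//; last by move=> i; rewrite tnth_mktuple; ring.
have -> : s = (1 - t) * (r + s) by rewrite mulrBl rE; ring.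
by rewrite ler_wpM2l// subr_ge0.
Qed.

(** Rounding each coordinate down to a multiple of [1 / (2 (d + 1))] moves a point
    by at most 1/2. *)
Lemma unit_ball_net : exists (I : finType) (p : I -> d.-tuple R),
  forall x, edist (origin d) x <= 1 -> exists j, edist (p j) x <= 1 / 2.
Proof.
pose N : nat := (2 * d.+1)%N.
have N0 : 0 < N%:R :> R by rewrite ltr0n.
exists {ffun 'I_d -> 'I_(N + N).+1}.
exists (fun j : {ffun 'I_d -> 'I_(N + N).+1} => [tuple (j i)%:R / N%:R - 1 | i < d]) => x /cball_sub_cube x1.
exists [ffun i => inord (Num.truncn ((tnth x i + 1) * N%:R))].
apply: edist_le_coord => // i; rewrite tnth_mktuple ffunE.
have := x1 i; rewrite ler_norml => /andP[xm xM].
have y0 : 0 <= (tnth x i + 1) * N%:R by rewrite mulr_ge0//; lra.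
have /andP[tl tu] := truncn_itv y0.
rewrite inordK; last first.
  rewrite ltnS -(@ler_nat R) natrD; apply: le_trans tl _.
  by nra.
have -> : 1 / 2 / d.+1%:R = N%:R^-1 :> R.
  by rewrite /N natrM invfM mul1r mulrC.
move: tl tu; rewrite -natr1; set T := (_)%:R => tl tu.
rewrite (_ : _ - _ = (T - (tnth x i + 1) * N%:R) / N%:R); last first.
  by field; rewrite gt_eqF.
rewrite normrM normfV (gtr0_norm N0) ler_piMl ?invr_ge0 ?(ltW N0)//.
by rewrite ler_norml; apply/andP; split; lra.
Qed.

Lemma rat_tuple_near x e : 0 < e ->
  exists q : d.-tuple rat, edist [tuple ratr (tnth q i) | i < d] x <= e.
Proof.
move=> e0; have e1 : 0 < e / d.+1%:R by rewrite divr_gt0.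
set delta := e / _ in e1.
have near i : {q : rat | `|ratr q - tnth x i| <= delta}.
  apply: cid; have /rat_in_itvoo[q] : tnth x i < tnth x i + delta by rewrite ltrDl.
  rewrite in_itv /= => /andP[q1 q2]; exists q.
  by rewrite ler_norml; apply/andP; split; lra.
exists [tuple sval (near i) | i < d]; apply: edist_le_coord; first exact: ltW.
by move=> i; rewrite !tnth_mktuple; case: (near i).
Qed.

End geometry.

(** * Relations that are countable unions of measurable rectangles *)

Section rectangular.
Context {dT : measure_display} {T : measurableType dT}.
Implicit Types rel : T -> T -> Prop.

(** The counterpart of openness for relations between grains: pairs of points of
    a random configuration that satisfy such a relation can be detected by
    asking which of countably many measurable sets contain points. *)
Definition rectangular rel := exists U V : nat -> set T,
  [/\ forall n, measurable (U n), forall n, measurable (V n) &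
      forall g g', rel g g' <-> exists n, U n g /\ V n g'].

Lemma eq_rectangular rel rel' :
  (forall g g', rel g g' <-> rel' g g') -> rectangular rel -> rectangular rel'.
Proof.
move=> e [U [V [mU mV UV]]]; exists U, V; split => // g g'.
by rewrite -e; exact: UV.
Qed.

(** Any countable index type will do, which keeps the closure properties below
    free of enumerations. *)
Lemma rectangular_countable (I : countType) (U V : I -> set T) :
  (forall i, measurable (U i)) -> (forall i, measurable (V i)) ->
  rectangular (fun g g' => exists i, U i g /\ V i g').
Proof.
move=> mU mV; pose ext W n := if @unpickle I n is Some i then W i else set0 : set T.
exists (ext U), (ext V); split => [n|n|g g'].
- by rewrite /ext; case: unpickle.
- by rewrite /ext; case: unpickle.
- split=> [[i [Ui Vi]]|[n []]]; first by exists (pickle i); rewrite /ext pickleK.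
  by rewrite /ext; case: unpickle => // i Ui Vi; exists i.
Qed.

Lemma rectangular_exists (I : countType) (rel : I -> T -> T -> Prop) :
  (forall i, rectangular (rel i)) ->
  rectangular (fun g g' => exists i, rel i g g').
Proof.
move=> /choice[U /choice[V UV]].
apply: (@eq_rectangular (fun g g' => exists p : I * nat, U p.1 p.2 g /\ V p.1 p.2 g')).
  move=> g g'; split.
    by move=> [[i n] h]; exists i; have [_ _ ->] := UV i; exists n.
  by move=> [i]; have [_ _ ->] := UV i => -[n h]; exists (i, n).
apply: (@rectangular_countable _ (fun p => U p.1 p.2) (fun p => V p.1 p.2)) => -[i n] /=.
  by have [mU _ _] := UV i; exact: mU.
by have [_ mV _] := UV i; exact: mV.
Qed.

Lemma rectangular_or rel rel' : rectangular rel -> rectangular rel' ->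
  rectangular (fun g g' => rel g g' \/ rel' g g').
Proof.
move=> r r'; apply: (@eq_rectangular (fun g g' => exists b : bool, (if b then rel else rel') g g')).
  move=> g g'; split=> [[[] h]|[h|h]]; [by left|by right|by exists true|by exists false].
by apply: rectangular_exists => -[].
Qed.

Lemma rectangular_and rel rel' : rectangular rel -> rectangular rel' ->
  rectangular (fun g g' => rel g g' /\ rel' g g').
Proof.
move=> [U [V [mU mV UV]]] [U' [V' [mU' mV' UV']]].
apply: (@eq_rectangular (fun g g' => exists p : nat * nat,
    (U p.1 `&` U' p.2) g /\ (V p.1 `&` V' p.2) g')).
  move=> g g'; split.
    by move=> [[n m] [[? ?] [? ?]]]; split; [apply/UV; exists n|apply/UV'; exists m].
  by move=> [/UV[n [? ?]] /UV'[m [? ?]]]; exists (n, m).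
apply: (@rectangular_countable _ (fun p => U p.1 `&` U' p.2) (fun p => V p.1 `&` V' p.2)) => -[n m];
  exact: measurableI.
Qed.

Lemma rectangular_sym rel : rectangular rel -> rectangular (fun g g' => rel g' g).
Proof.
move=> [U [V [mU mV UV]]]; exists V, U; split => // g g'.
by rewrite UV; split=> -[n [? ?]]; exists n.
Qed.

Section order.
Context {R : realType}.

Lemma ereal_rat_between (x y : \bar R) : (x < y)%E ->
  exists q : rat, (x < (ratr q)%:E < y)%E.
Proof.
have between (a b : R) : a < b -> exists q : rat, a < ratr q < b.
  by move=> /rat_in_itvoo[q]; rewrite in_itv /=; exists q.
case: x y => [x| |] [y| |] //.
- by rewrite lte_fin => /between[q]; exists q; rewrite !lte_fin.
- have /between[q /andP[xq _] _] : x < x + 1 by rewrite ltrDl.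
  by exists q; rewrite lte_fin xq ltry.
- have /between[q /andP[_ qy] _] : y - 1 < y by rewrite ltrBlDr ltrDl.
  by exists q; rewrite lte_fin qy ltNyr.
- by exists 0; rewrite ltry ltNyr.
Qed.

Lemma rectangular_lte (f h : T -> \bar R) :
  measurable_fun setT f -> measurable_fun setT h ->
  rectangular (fun g g' => (f g < h g')%E).
Proof.
move=> mf mh; apply: (@eq_rectangular (fun g g' => exists q : rat,
    [set g | (f g < (ratr q)%:E)%E] g /\ [set g | ((ratr q)%:E < h g)%E] g')).
  move=> g g'; split=> [[q /= [fq qh]]|/ereal_rat_between[q /andP[fq qh]]].
    exact: lt_trans fq qh.
  by exists q.
apply: rectangular_countable => q; rewrite -[X in measurable X]setTI.
  exact: emeasurable_fun_infty_o.
exact: emeasurable_fun_o_infty.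
Qed.

Lemma rectangular_lt (f h : T -> R) :
  measurable_fun setT f -> measurable_fun setT h ->
  rectangular (fun g g' => f g < h g').
Proof.
move=> /measurable_EFinP mf /measurable_EFinP mh.
by apply: (eq_rectangular _ (rectangular_lte mf mh)) => g g'; rewrite /= lte_fin.
Qed.

Lemma rectangular_neqe (f : T -> \bar R) : measurable_fun setT f ->
  rectangular (fun g g' => f g <> f g').
Proof.
move=> mf; apply: (eq_rectangular _ (rectangular_or (rectangular_lte mf mf)
  (rectangular_sym (rectangular_lte mf mf)))) => g g'; split.
  by move=> [] + e; rewrite e ltxx.
by case: (ltgtP (f g) (f g')) => //; [left|right].
Qed.

Lemma rectangular_neq (f : T -> R) : measurable_fun setT f ->
  rectangular (fun g g' => f g <> f g').
Proof.
move=> /measurable_EFinP mf.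
by apply: (eq_rectangular _ (rectangular_neqe mf)) => g g'; split=> h e; apply: h;
  [rewrite /= e|case: e].
Qed.

End order.

End rectangular.

(** * Void events of a random point set *)

Section void_events.
Context {dO dT : measure_display} {Omega : measurableType dO} {T : measurableType dT}.
Variable Phi : Omega -> set T.

Definition void (B : set T) : set Omega := [set omega | Phi omega `&` B = set0].

(** Void events are closed under intersection, their probabilities are explicit,
    and they turn out to generate all the events of interest. *)
Definition void_sets (V : set T) : set (set Omega) :=
  [set E | exists B, [/\ measurable B, B `<=` V & E = void B]].

Lemma voidU B C : void (B `|` C) = void B `&` void C.
Proof.
apply/seteqP; split => omega; rewrite /void /= setIUr.
  by rewrite setU_eq0.
by move=> [-> ->]; rewrite setU0.
Qed.

Lemma subset_void B C : B `<=` C -> void C `<=` void B.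
Proof.
move=> BC omega /= C0; apply/seteqP; split => // g [Pg Bg].
by rewrite -C0; split => //; exact: BC.
Qed.

Lemma not_void B omega : ~ void B omega <-> exists g, Phi omega g /\ B g.
Proof.
split=> [/eqP/set0P[g [? ?]]|[g [? ?]] B0]; first by exists g.
by have : (Phi omega `&` B) g by []; rewrite B0.
Qed.

Lemma void_notin B omega g : void B omega -> Phi omega g -> ~ B g.
Proof.
by move=> B0 Pg Bg; have : (Phi omega `&` B) g by []; rewrite B0.
Qed.

Lemma void_sets_setI_closed V : setI_closed (void_sets V).
Proof.
move=> _ _ [B [mB BV ->]] [C [mC CV ->]]; exists (B `|` C); split.
- exact: measurableU.
- by rewrite subUset.
- by rewrite voidU.
Qed.

Section sigma_algebra_of_a_window.
Variable V : set T.
Local Notation S := (g_sigma_algebraType (void_sets V)).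

Lemma g_void B : measurable B -> B `<=` V -> measurable (void B : set S).
Proof. by move=> mB BV; apply: sub_sigma_algebra; exists B. Qed.

(** Two distinct points lie in the two sides of one of countably many
    rectangles, so that having at most one point means that each of these
    rectangles has an empty side. *)
Lemma g_at_most_one X : rectangular (fun g g' : T => g <> g') ->
  measurable X -> X `<=` V ->
  measurable ([set omega | forall g g', (Phi omega `&` X) g ->
    (Phi omega `&` X) g' -> g = g'] : set S).
Proof.
move=> [U [W [mU mW UW]]] mX XV.
rewrite (_ : [set _ | _] = \bigcap_n (void (X `&` U n) `|` void (X `&` W n))).
  apply: bigcapT_measurable => n; apply: measurableU; apply: g_void;
    by [exact: measurableI|move=> g [/XV]].
apply/seteqP; split => omega /=.
  move=> one n _; apply: contrapT => /not_orP[/not_void[g [Pg [Xg Ug]]] /not_void[g' [Pg' [Xg' Wg']]]].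
  have /UW : exists n, U n g /\ W n g' by exists n.
  by apply; exact: one.
move=> h g g' [Pg Xg] [Pg' Xg']; apply: contrapT => /UW[n [Ug Wg']].
by have [v|v] := h n Logic.I; [exact: (void_notin v Pg)|exact: (void_notin v Pg')].
Qed.

(** A point [g] of a finite configuration is in [rel] with all the others if and
    only if finitely many of the rectangles that make up [rel] have [g] in
    their first side and all the other points in their second side. *)
Lemma g_survivor (A : set T) (rel : T -> T -> Prop) :
  rectangular (fun g g' : T => g <> g') -> rectangular rel ->
  measurable V -> (forall omega, finite_set (Phi omega `&` V)) ->
  measurable A -> A `<=` V ->
  measurable ([set omega | exists g, [/\ Phi omega g, A g &
    forall g', Phi omega g' -> V g' -> g' <> g -> rel g g']] : set S).
Proof.
move=> rneq rrel mV finV mA AV.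
have [U [W [mU mW UW]]] := rectangular_and rneq rrel.
pose UL (L : seq nat) := \bigcap_(n in [set` L]) U n.
pose WL (L : seq nat) := \bigcup_(n in [set` L]) W n.
have mUL L : measurable (UL L) by exact: fin_bigcap_measurable.
have mWL L : measurable (WL L) by exact: fin_bigcup_measurable.
rewrite (_ : [set _ | _] = \bigcup_(L : seq nat) (~` void (A `&` UL L) `&`
    [set omega | forall g g', (Phi omega `&` (V `\` WL L)) g ->
      (Phi omega `&` (V `\` WL L)) g' -> g = g'])).
  apply: countable_bigcupT_measurable => // L; apply: measurableI.
    by apply: measurableC; apply: g_void; [exact: measurableI|move=> g [/AV]].
  by apply: g_at_most_one => //; exact: measurableD.
apply/seteqP; split => omega /=; last first.
  move=> [L _ [/not_void[g [Pg [Ag Ug]]] one]]; exists g; split => // g' Pg' Vg' gg'.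
  have [[n nL Wg']|nW] := pselect (WL L g').
    by have [_ ?] := (UW g g').2 (ex_intro _ n (conj (Ug n nL) Wg')).
  case: gg'; apply: one => //; split => //; split; first exact: AV.
  by move=> [n nL Wg]; have [] := (UW g g).2 (ex_intro _ n (conj (Ug n nL) Wg)).
move=> [g [Pg Ag rg]].
have [n nP] : {n : T -> nat & forall g', Phi omega g' -> V g' -> g' <> g ->
    U (n g') g /\ W (n g') g'}.
  apply: (choice (P := fun g' n => Phi omega g' -> V g' -> g' <> g -> U n g /\ W n g')) => g'.
  have [[Pg' [Vg' gg']]|h] := pselect (Phi omega g' /\ V g' /\ g' <> g); last first.
    by exists 0%N => ? ? ?; exfalso; apply: h.
  have /UW[n nP] : g <> g' /\ rel g g' by split; [exact: nesym|exact: rg].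
  by exists n.
have /finite_seqP[s sE] := finV omega.
have in_s g' : g' \in s <-> Phi omega g' /\ V g'.
  split=> [gs|Vg']; first by have : [set` s] g' by []; rewrite -sE.
  by have : (Phi omega `&` V) g' by []; rewrite sE.
exists [seq n g' | g' <- s & g' != g] => //; split.
  apply/not_void; exists g; split => //; split => // _ /= /mapP[g' + ->].
  by rewrite mem_filter => /andP[/eqP gg' /in_s[Pg' Vg']]; have [] := nP g' Pg' Vg' gg'.
have only g' : (Phi omega `&` (V `\` WL [seq n g' | g' <- s & g' != g])) g' -> g' = g.
  move=> [Pg' [Vg' nW]]; apply: contrapT => gg'; apply: nW.
  exists (n g') => /=; last by have [] := nP g' Pg' Vg' gg'.
  by apply/mapP; exists g' => //; rewrite mem_filter; apply/andP; split; [exact/eqP|exact/in_s].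
by move=> g1 g2 /only -> /only ->.
Qed.

End sigma_algebra_of_a_window.

Context {R : realType} (P : probability Omega R) (Lambda : set T -> \bar R).
Hypothesis poisson : is_poisson P Phi Lambda.

Lemma void_npoints B : void B = npoints (R := R) Phi B @^-1` [set 0%:E].
Proof.
apply/seteqP; split => omega; rewrite /void /npoints /counting /=.
  by move=> ->; rewrite asboolT//  fset_set0.
case: asboolP => // fin [] /eqP; rewrite pnatr_eq0 finmap.cardfs_eq0 => /eqP.
by move=> h; rewrite -(fset_setK fin) h set_fset0.
Qed.

Lemma measurable_void B : measurable B -> measurable (void B).
Proof.
move=> mB; rewrite void_npoints -[X in measurable X]setTI.
by apply: (npoints_measurable poisson) => //; exact: emeasurable_set1.
Qed.

Lemma P_void B : measurable B -> (Lambda B < +oo)%E ->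
  P (void B) = (expR (- fine (Lambda B)))%:E.
Proof.
move=> mB LB; rewrite void_npoints (npoints_poisson poisson mB LB 0).
by rewrite expr0 fact0 mul1r invr1 mul1r.
Qed.

Lemma P_void_infinite B : measurable B -> Lambda B = +oo%E -> P (void B) = 0%E.
Proof.
move=> mB LB; apply/eqP; rewrite eq_le measure_ge0 andbT.
have mI : measurable (npoints (R := R) Phi B @^-1` [set +oo%E]).
  rewrite -[X in measurable X]setTI.
  by apply: (npoints_measurable poisson) => //; exact: emeasurable_set1.
rewrite -(subee (x := 1%E))// -{2}(npoints_infinite poisson mB LB).
rewrite -probability_setC//; apply: le_measure; rewrite ?inE.
- exact: measurable_void.
- exact: measurableC.
- by rewrite void_npoints => omega /= ->.
Qed.

Lemma eq_P_void B C : measurable B -> measurable C -> Lambda B = Lambda C ->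
  P (void B) = P (void C).
Proof.
move=> mB mC BC; have [C_oo|C_fin] := eqVneq (Lambda C) +oo%E.
  by rewrite !P_void_infinite// BC.
by rewrite !P_void ?BC// ltey.
Qed.

Lemma P_voidI B C : measurable B -> measurable C -> B `&` C = set0 ->
  P (void B `&` void C) = (P (void B) * P (void C))%E.
Proof.
move=> mB mC BC; pose X (i : 'I_2) := if i == ord0 then B else C.
have mX i : measurable (X i) by rewrite /X; case: ifP.
have tX : trivIset setT X.
  apply/trivIsetP => -[[|[|//]] ?] [[|[|//]] ?] _ _ //=; rewrite /X //=.
  by rewrite setIC.
have := npoints_independent poisson mX tX (A := fun=> [set 0%:E])
  (fun=> emeasurable_set1 0%:E).
rewrite big_ord_recl big_ord1 /X /= -!void_npoints => <-.
congr (P _); apply/seteqP; split => omega.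
  by move=> [B0 C0] i _; rewrite -void_npoints; case: ifP.
by move=> h; split; [have := h ord0 Logic.I|have := h (lift ord0 ord0) Logic.I];
  rewrite -void_npoints.
Qed.

Lemma null_void B : measurable B -> Lambda B = 0%E -> P (void B) = 1%E.
Proof. by move=> mB LB; rewrite P_void// LB// oppr0 expR0. Qed.

(** A pi-lambda argument: the events independent of [Q] form a Dynkin system. *)
Lemma independent_sigma_algebra (G : set (set Omega)) (Q : set Omega) :
  setI_closed G -> G `<=` measurable -> measurable Q ->
  (forall A, G A -> P (A `&` Q) = (P A * P Q)%E) ->
  forall A, <<s G >> A -> measurable A /\ P (A `&` Q) = (P A * P Q)%E.
Proof.
move=> GI Gm mQ GQ.
pose indep (A : set Omega) := measurable A /\ P (A `&` Q) = (P A * P Q)%E.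
have indepC A : indep A -> indep (~` A).
  move=> [mA AQ]; split; first exact: measurableC.
  rewrite probability_setC// (setIC (~` A)) -setDE measureD//; last first.
    by rewrite ltey_eq fin_num_measure.
  rewrite [X in (_ - X)%E](_ : _ = P A * P Q)%E; last by rewrite setIC; exact: AQ.
  by rewrite muleBl ?mul1e ?fin_num_measure// fin_num_adde_defr.
have indep_bigcup (F : (set Omega)^nat) : trivIset setT F ->
    (forall n, indep (F n)) -> indep (\bigcup_n F n).
  move=> tF PF; have mF n : measurable (F n) by have [] := PF n.
  split; first exact: bigcupT_measurable.
  rewrite setI_bigcupl measure_bigcup//=; last 2 first.
    by move=> n _; exact: measurableI.
    exact: trivIset_setIr.
  rewrite measure_bigcup// muleC -(fineK (fin_num_measure P Q mQ)) -nneseriesZl//.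
  by apply: eq_eseriesr => n _; have [_ ->] := PF n; rewrite muleC fineK// fin_num_measure.
apply: (@dynkin_induction _ (g_sigma_algebraType G) G indep) => //.
- by split; [exact: measurableT|rewrite setTI probability_setT mul1e].
- by move=> A GA; split; [exact: Gm|exact: GQ].
- by move=> A _; exact: indepC.
- by move=> F _; exact: indep_bigcup.
Qed.

(** The pi-lambda argument once for each window. *)
Lemma independent_windows (V V' : set T) (E E' : set Omega) :
  V `&` V' = set0 -> <<s void_sets V >> E -> <<s void_sets V' >> E' ->
  [/\ measurable E, measurable E' & P (E `&` E') = (P E * P E')%E].
Proof.
move=> VV' sE sE'.
have sub X : void_sets X `<=` measurable by move=> _ [B [mB _ ->]]; exact: measurable_void.
have half A : void_sets V A -> measurable E' /\ P (E' `&` A) = (P E' * P A)%E.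
  move=> [B [mB BV ->]].
  apply: (@independent_sigma_algebra (void_sets V')) => //.
  - exact: void_sets_setI_closed.
  - exact: measurable_void.
  - move=> _ [C [mC CV' ->]]; apply: P_voidI => //.
    by apply/seteqP; split => // g [/CV' ? /BV ?]; rewrite -VV'.
have mE' : measurable E' by have [] := half _ (ex_intro _ set0 (And3 measurable0 (@sub0set _ _) erefl)).
have [] : measurable E /\ P (E `&` E') = (P E * P E')%E.
  apply: (@independent_sigma_algebra (void_sets V)) => //.
  - exact: void_sets_setI_closed.
  - by move=> A /half[_]; rewrite setIC muleC.
by split.
Qed.

End void_events.

(** * Grains, their killers and their intensity *)

Section grains.
Context {R : realType} {d : nat}.
Implicit Types g : grain R d.

Lemma measurable_center : measurable_fun setT (@center R d).
Proof. exact: (measurableT_comp measurable_fst measurable_fst). Qed.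

Lemma measurable_radius : measurable_fun setT (@radius R d).
Proof. exact: (measurableT_comp measurable_snd measurable_fst). Qed.

Lemma measurable_weight : measurable_fun setT (@weight R d).
Proof. exact: measurable_snd. Qed.

Lemma measurable_edist_center (q : d.-tuple R) :
  measurable_fun setT (fun g => edist q (center g)).
Proof. exact: (measurableT_comp (measurable_edist q) measurable_center). Qed.

Lemma rectangular_grain_neq : rectangular (fun g g' => g <> g').
Proof.
apply: (@eq_rectangular _ _ (fun g g' =>
    (exists i : 'I_d, tnth (center g) i <> tnth (center g') i) \/
    (radius g <> radius g' \/ weight g <> weight g'))).
  move=> [[x r] w] [[x' r'] w']; rewrite /center /radius /weight /=; split.
    by move=> [[i]|[]] h [xx' rr' ww']; apply: h; rewrite ?xx'.
  move=> h; apply: contrapT => /not_orP[xx' /not_orP[/contrapT rr' /contrapT ww']].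
  apply: h; rewrite rr' ww'; congr ((_, _), _); apply/eq_from_tnth => i.
  by apply: contrapT => ?; apply: xx'; exists i.
apply: rectangular_or.
  apply: rectangular_exists => i; apply: rectangular_neq.
  exact: (measurableT_comp (measurable_tnth i) measurable_center).
apply: rectangular_or; first exact: (rectangular_neq measurable_radius).
exact: (rectangular_neqe measurable_weight).
Qed.

Definition survives g g' := body g' `&` body g !=set0 -> (weight g' < weight g)%E.

Lemma survivesP g g' : 0 <= radius g -> 0 <= radius g' ->
  survives g g' <-> ((weight g' < weight g)%E \/
    radius g + radius g' < edist (center g) (center g')).
Proof.
move=> r0 r'0; rewrite /survives /body; split.
  have [lt|le] := ltP (radius g + radius g') (edist (center g) (center g')); first by right.
  by move=> h; left; apply: h; apply/cball_meetP => //; rewrite edistC addrC.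
move=> [//|lt] /cball_meetP; move=> /(_ r'0 r0); rewrite edistC addrC.
by rewrite leNgt lt.
Qed.

(** For two bodies that do not meet, a rational point near the center of [g]
    witnesses the strict inequality by a condition on each grain. *)
Lemma rectangular_spares : rectangular (fun g g' => (weight g' < weight g)%E \/
  radius g + radius g' < edist (center g) (center g')).
Proof.
apply: rectangular_or.
  by apply: (@rectangular_sym _ _ (fun g g' => (weight g < weight g')%E));
    apply: rectangular_lte; exact: measurable_weight.
pose pt (q : d.-tuple rat) : d.-tuple R := [tuple ratr (tnth q i) | i < d].
apply: (@eq_rectangular _ _ (fun g g' => exists q : d.-tuple rat,
    edist (pt q) (center g) + radius g < edist (pt q) (center g') - radius g')).
  move=> g g'; split=> [[q h]|h].
    have := edist_triangle (pt q) (center g) (center g'); lra.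
  pose e := (edist (center g) (center g') - (radius g + radius g')) / 3.
  have e0 : 0 < e by rewrite divr_gt0// subr_gt0.
  have eE : 3 * e = edist (center g) (center g') - (radius g + radius g').
    by rewrite /e; field.
  have [q qe] := rat_tuple_near (center g) e0; exists q; rewrite -/(pt q) in qe.
  have := edist_triangle (center g) (pt q) (center g').
  rewrite (edistC (center g) (pt q)); lra.
apply: rectangular_exists => q; apply: rectangular_lt.
  by apply: measurable_funD; [exact: measurable_edist_center|exact: measurable_radius].
by apply: measurable_funB; [exact: measurable_edist_center|exact: measurable_radius].
Qed.

Lemma rectangular_section dT (T : measurableType dT) (rel : T -> T -> Prop) (g : T) :
  rectangular rel -> measurable [set g' | rel g g'].
Proof.
move=> [U [V [mU mV UV]]].
rewrite (_ : [set _ | _] = \bigcup_(n in [set n | U n g]) V n).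
  exact: bigcup_measurable.
apply/seteqP; split => g' /=; first by move=> /UV[n [? ?]]; exists n.
by move=> [n ? ?]; apply/UV; exists n.
Qed.

(** By [survives], a retained grain is one whose set of killers is void. *)
Definition killers g := [set g' | [/\ 0 <= radius g', g' <> g & ~ survives g g']].

Lemma cball_lt0 (x : d.-tuple R) r : r < 0 -> cball x r = set0.
Proof.
move=> r0; apply/seteqP; split => // y; rewrite /cball /= => yr.
by have := lt_le_trans (le_lt_trans yr r0) (edist_ge0 x y); rewrite ltxx.
Qed.

Lemma survives_lt0 g g' : radius g < 0 -> survives g g'.
Proof. by move=> r0; rewrite /survives /body (cball_lt0 _ r0) setI0 => -[]. Qed.

Lemma measurable_nonneg : measurable [set g : grain R d | 0 <= radius g].
Proof.
by rewrite -[X in measurable X]setTI; apply: measurable_fun_le => //; exact: measurable_radius.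
Qed.

Lemma measurable_killers g : measurable (killers g).
Proof.
have [r0|r0] := ltP (radius g) 0.
  rewrite (_ : killers g = set0)//; apply/seteqP; split => // g' [_ _].
  by apply; exact: survives_lt0.
rewrite (_ : killers g = [set g' | 0 <= radius g'] `&` [set g' | g <> g'] `&`
    ~` [set g' | (weight g' < weight g)%E \/
      radius g + radius g' < edist (center g) (center g')]).
  apply: measurableI; last first.
    by apply: measurableC; exact: (@rectangular_section _ _ _ g rectangular_spares).
  apply: measurableI; first exact: measurable_nonneg.
  exact: (@rectangular_section _ _ _ g rectangular_grain_neq).
apply/seteqP; split => g' /=.
  by move=> [r'0 gg' h]; split; [split => //; exact: nesym|rewrite -survivesP].
by move=> [[r'0 gg'] h]; split => //; [exact: nesym|rewrite survivesP].
Qed.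

Definition shift (a : d.-tuple R) g : grain R d :=
  (affine a 1 (center g), radius g, weight g).

Lemma measurable_shift a : measurable_fun setT (shift a).
Proof.
apply/measurable_fun_pair; last exact: measurable_weight.
apply/measurable_fun_pair; last exact: measurable_radius.
exact: (measurableT_comp (measurable_affine a 1) measurable_center).
Qed.

(** Translations move killers along with their victims; this is the source of
    stationarity. *)
Lemma killers_shift a g : shift a @^-1` killers (shift a g) = killers g.
Proof.
have aff_inj : injective (affine a 1).
  move=> x y h; apply/eq_from_tnth => i; have := congr1 (fun v => tnth v i) h.
  by rewrite !tnth_mktuple !mul1r => /addrI.
have meet g' : (body (shift a g') `&` body (shift a g) !=set0) <->
    (body g' `&` body g !=set0).
  split.
    move=> [y]; have -> : y = affine a 1 [tuple tnth y i - tnth a i | i < d].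
      by apply/eq_from_tnth => i; rewrite !tnth_mktuple; ring.
    set y' := [tuple _ | _ < _]; rewrite /body /cball /= !edist_affine// !mul1r => h.
    by exists y'.
  move=> [y h]; exists (affine a 1 y); move: h.
  by rewrite /body /cball /= !edist_affine// !mul1r.
apply/seteqP; split => g' [r'0 gg' h]; split => //.
- by move=> e; apply: gg'; rewrite e.
- by move=> s; apply: h => /meet /s.
- move=> e; apply: gg'.
  move: (congr1 (@center R d) e) (congr1 (@radius R d) e) (congr1 (@weight R d) e).
  case: g g' {r'0 h meet e} => [[x r] w] [[x' r'] w'].
  by rewrite /shift /center /radius /weight /= => /aff_inj -> -> ->.
- by move=> s; apply: h => /meet /s.
Qed.

End grains.

Section retention_events.
Context {R : realType} {d : nat} {dO : measure_display} {Omega : measurableType dO}.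
Variable Phi : Omega -> set (grain R d).
Hypothesis Phi_nonneg : forall omega g, Phi omega g -> 0 <= radius g.

Lemma void_killersP omega g :
  void Phi (killers g) omega <->
  forall g', Phi omega g' -> g' <> g -> survives g g'.
Proof.
split=> [h g' Pg' gg'|h].
  apply: contrapT => s; apply: (void_notin h Pg'); split => //.
  exact: Phi_nonneg Pg'.
apply: contrapT => /not_void[g' [Pg' [_ gg']]]; apply; exact: h.
Qed.

Lemma retained1E g :
  [set omega | thin (Phi omega `|` [set g]) g] = void Phi (killers g).
Proof.
apply/seteqP; split => omega /=.
  by move=> [_ h]; apply/void_killersP => g' Pg' gg'; apply: h => //; left.
move=> /void_killersP h; split; first by right.
by move=> g' [Pg' gg'|-> //]; exact: h.
Qed.

Lemma retained2E g1 g2 : g1 <> g2 -> survives g1 g2 -> survives g2 g1 ->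
  [set omega | let phi := Phi omega `|` [set g1; g2] in
    [/\ g1 <> g2, thin phi g1 & thin phi g2]] =
  void Phi (killers g1) `&` void Phi (killers g2).
Proof.
move=> g12 s12 s21; apply/seteqP; split => omega /=.
  move=> [_ [_ h1] [_ h2]]; split; apply/void_killersP => g' Pg' gg'.
    by apply: h1 => //; left.
  by apply: h2 => //; left.
move=> [/void_killersP h1 /void_killersP h2]; split => //; split.
- by right; left.
- by move=> g' [Pg' gg'|[-> //|-> //]]; exact: h1.
- by right; right.
- by move=> g' [Pg' gg'|[-> //|-> //]]; exact: h2.
Qed.

Lemma retained2_incompatible g1 g2 : ~ [/\ g1 <> g2, survives g1 g2 & survives g2 g1] ->
  [set omega | let phi := Phi omega `|` [set g1; g2] in
    [/\ g1 <> g2, thin phi g1 & thin phi g2]] = set0.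
Proof.
move=> h; apply/seteqP; split => // omega /= [g12 [_ h1] [_ h2]].
apply: h; split => //.
  by apply: h1; [right; right|exact: nesym].
by apply: h2 => //; right; left.
Qed.

End retention_events.

Section intensity.
Context {R : realType} {d : nat}.
Variables (lambda : R) (F : probability R R).
Local Notation Lambda := (grain_intensity (d := d) lambda F favor_small_kernel).

(** The intensity is carried by the image of this map. *)
Definition typical_grain (p : d.-tuple R * measurableTypeR R) : grain R d :=
  (p.1, p.2, inverse_radius p.2).

Lemma measurable_typical_grain : measurable_fun setT typical_grain.
Proof.
apply/measurable_fun_pair; last first.
  exact: (measurableT_comp measurable_inverse_radius measurable_snd).
by apply/measurable_fun_pair; [exact: measurable_fst|exact: measurable_snd].
Qed.

Lemma measurable_typical B : measurable B -> measurable (typical_grain @^-1` B).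
Proof.
by move=> mB; rewrite -[X in measurable X]setTI; exact: measurable_typical_grain.
Qed.

Lemma intensityE B : measurable B -> Lambda B =
  (lambda%:E * \int[lebesgue_Rd d]_x F (xsection (typical_grain @^-1` B) x))%E.
Proof.
move=> mB; rewrite /grain_intensity; congr (_ * _)%E.
apply: eq_integral => x _.
have mx := measurable_xsection x (measurable_typical mB).
rewrite -[X in F X]setIT -(integral_indic F measurableT mx).
apply: eq_integral => r _; rewrite /= /kdirac diracE indicE; congr ((nat_of_bool _)%:R%:E).
by apply/idP/idP; rewrite !inE /xsection /= inE.
Qed.

Lemma intensity_shift a B : measurable B -> Lambda (shift a @^-1` B) = Lambda B.
Proof.
move=> mB; have mD := measurable_typical mB.
rewrite !intensityE//; last first.
  by rewrite -[X in measurable X]setTI; exact: measurable_shift.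
congr (_ * _)%E.
rewrite -(@ge0_integral_translation _ _ a (fun x => F (xsection (typical_grain @^-1` B) x)))//.
exact: measurable_fun_xsection.
Qed.

Lemma inverse_radius_le (r s : R) : 0 <= r -> 0 <= s ->
  (inverse_radius r <= inverse_radius s)%E = (s <= r).
Proof.
rewrite /inverse_radius !inver => r0 s0.
have [->|rn] := eqVneq r 0; have [->|sn] := eqVneq s 0.
- by rewrite !lexx.
- rewrite leye_eq /=; apply/esym/negbTE; rewrite -ltNge lt_neqAle s0 andbT.
  by rewrite eq_sym.
- by rewrite leey r0.
- by rewrite lee_fin lef_pV2// posrE lt_neqAle eq_sym ?rn ?sn.
Qed.

(** An intensity-null set, but one that some realizations may charge: every
    argument that compares radii through weights has to discard it. *)
Definition off_diagonal := [set g : grain R d | weight g <> inverse_radius (radius g)].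

Lemma measurable_off_diagonal : measurable off_diagonal.
Proof.
have mi : measurable_fun setT (fun g : grain R d => inverse_radius (radius g)).
  exact: (measurableT_comp measurable_inverse_radius measurable_radius).
rewrite (_ : off_diagonal = setT `&` [set g | weight g != inverse_radius (radius g)]).
  by apply: measurable_neqe => //; exact: measurable_weight.
by rewrite setTI; apply/seteqP; split => g /eqP.
Qed.

Lemma intensity_off_diagonal : Lambda off_diagonal = 0%E.
Proof.
rewrite intensityE; last exact: measurable_off_diagonal.
rewrite (_ : _ @^-1` _ = set0); first last.
  by apply/seteqP; split => // -[x r] /=.
under eq_integral do rewrite xsection0 measure0.
by rewrite integral0 mule0.
Qed.

(** The intensity only charges grains that satisfy the constraint on weights
    already; the constraint lets every grain of a box remove, whatever the
    realization, the grains of radius at least [t] that it meets. *)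
Definition box (y : d.-tuple R) (rho t : R) := [set g : grain R d |
  [/\ cball y rho (center g), 0 <= radius g < t & (inverse_radius t <= weight g)%E]].

Lemma measurable_box y rho t : measurable (box y rho t).
Proof.
rewrite (_ : box y rho t = (@center R d @^-1` cball y rho) `&`
    (@radius R d @^-1` `[0, t[) `&` (setT `&` [set g | (inverse_radius t <= weight g)%E])).
  apply: measurableI; last by apply: emeasurable_fun_c_infty => //; exact: measurable_weight.
  apply: measurableI; rewrite -[X in measurable X]setTI.
    by apply: measurable_center => //; exact: measurable_cball.
  by apply: measurable_radius.
rewrite setTI; apply/seteqP; split => g /=.
  by rewrite /box /= in_itv /= => -[].
by rewrite /box /= in_itv /= => -[[]].
Qed.

Lemma intensity_box y rho t : 0 < rho -> Lambda (box y rho t) =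
  (lambda * unit_ball_volume d * rho ^+ d * fine (F `[0, t[%classic))%:E.
Proof.
move=> rho0; rewrite intensityE; last exact: measurable_box.
have mI : measurable `[0, t[%classic by exact: measurable_itv.
rewrite (_ : _ @^-1` _ = cball y rho `*` `[0, t[%classic); last first.
  apply/seteqP; split => -[x r] /=.
    by move=> [h /= rt _]; split => //=; rewrite in_itv.
  move=> [/= xy]; rewrite in_itv /= => rt; split => //.
  have /andP[r0 r1] := rt.
  by rewrite /= inverse_radius_le// ?(ltW r1)// (le_trans r0)// ltW.
rewrite [X in (_ * X)%E](product_measure1E (lebesgue_Rd d) F (measurable_cball y rho) mI).
rewrite [X in (_ * (X * _))%E](lebesgue_Rd_cball y rho0) -[X in (_ * (_ * X))%E](fineK (fin_num_measure F _ mI)).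
by rewrite -!EFinM; congr EFin; ring.
Qed.

End intensity.

(** * Retention probabilities *)

Section retention.
Context {R : realType} {d : nat} {dO : measure_display} {Omega : measurableType dO}.
Variables (P : probability Omega R) (lambda : R) (F : probability R R)
  (Phi : Omega -> set (grain R d)).
Hypothesis hPhi : is_grain_process P lambda F favor_small_kernel Phi.

Let poisson := grain_poisson hPhi.

Let Phi_nonneg omega g (Pg : Phi omega g) : 0 <= radius g :=
  (grain_nonneg hPhi Pg).1.

Definition void_prob (B : set (grain R d)) : R := fine (P (void Phi B)).

Definition reference (x : d.-tuple R) (r : R) : grain R d := (x, r, inverse_radius r).

Lemma void_prob_ge0 B : 0 <= void_prob B.
Proof. by rewrite fine_ge0. Qed.

Lemma P_voidE B : measurable B -> P (void Phi B) = (void_prob B)%:E.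
Proof. by move=> mB; rewrite fineK// fin_num_measure//; exact: (measurable_void poisson). Qed.

Lemma void_prob_le B C : measurable B -> measurable C -> B `<=` C ->
  void_prob C <= void_prob B.
Proof.
move=> mB mC BC; rewrite -lee_fin -!P_voidE//; apply: le_measure; rewrite ?inE.
- exact: (measurable_void poisson).
- exact: (measurable_void poisson).
- exact: subset_void.
Qed.

Lemma void_probU B C : measurable B -> measurable C -> B `&` C = set0 ->
  void_prob (B `|` C) = void_prob B * void_prob C.
Proof.
move=> mB mC BC; apply: EFin_inj.
rewrite EFinM -!P_voidE//; last exact: measurableU.
by rewrite voidU; exact: (P_voidI poisson).
Qed.

Lemma void_prob_off_diagonal : void_prob off_diagonal = 1.
Proof.
apply: EFin_inj; rewrite -P_voidE; last exact: measurable_off_diagonal.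
by apply: (null_void poisson); [exact: measurable_off_diagonal|exact: intensity_off_diagonal].
Qed.

(** This lets killers be compared with their victims through radii. *)
Lemma void_prob_diagonal B : measurable B ->
  void_prob (B `\` off_diagonal) = void_prob B.
Proof.
move=> mB; have mW := @measurable_off_diagonal R d.
have mBW : measurable (B `\` off_diagonal) by exact: measurableD.
apply: le_anti; apply/andP; split; last by apply: void_prob_le => // g [].
rewrite -[leLHS]mulr1 -void_prob_off_diagonal -void_probU//; last first.
  by apply/seteqP; split => // g [[]].
apply: void_prob_le => //; first exact: measurableU.
by move=> g Bg; have [Wg|Wg] := pselect (off_diagonal g); [right|left].
Qed.

Lemma void_prob_shift a g : void_prob (killers (shift a g)) = void_prob (killers g).
Proof.
congr fine; apply: (eq_P_void poisson).
- exact: measurable_killers.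
- exact: measurable_killers.
- by rewrite -(intensity_shift _ _ a (measurable_killers _)) killers_shift.
Qed.

Lemma void_prob_reference x r :
  void_prob (killers (reference x r)) = void_prob (killers (reference (origin d) r)).
Proof.
rewrite -[RHS](void_prob_shift x); congr (void_prob (killers _)).
by rewrite /shift /reference /center /radius /weight /= affine_origin.
Qed.

Lemma void_prob_box y rho t : 0 < rho -> void_prob (box y rho t) =
  expR (- (lambda * unit_ball_volume d * rho ^+ d * fine (F `[0, t[%classic))).
Proof.
move=> rho0; rewrite /void_prob (P_void poisson) ?intensity_box ?ltry//.
exact: measurable_box.
Qed.

(** Every grain of the box [box x t t] is centered in the body of the reference
    grain and removes it. *)
Lemma void_prob_killers_le x t s : 0 < t -> t <= s ->
  void_prob (killers (reference x s)) <=
  expR (- (lambda * unit_ball_volume d * t ^+ d * fine (F `[0, t[%classic))).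
Proof.
move=> t0 ts; rewrite -(void_prob_box x)//.
apply: void_prob_le; [exact: measurable_box|exact: measurable_killers|].
move=> g' [xg' /andP[r'0 r't] w']; split => //.
  by move=> e; move: r't; rewrite e /radius /= ltNge ts.
rewrite /survives => h; suff /h : body g' `&` body (reference x s) !=set0.
  rewrite ltNge (le_trans _ w')// inverse_radius_le// ?(ltW t0)//.
  exact: le_trans (ltW t0) ts.
exists (center g'); rewrite /body /cball /=; split; first by rewrite edistxx.
exact: le_trans xg' ts.
Qed.

Lemma retentionE r :
  retention P favor_small_kernel Phi r = void_prob (killers (reference (origin d) r)).
Proof.
rewrite /retention (@ge0_Rintegral_dirac _ _ _ (inverse_radius r)).
- by rewrite /retention_w (retained1E Phi_nonneg).
- exact: emeasurable_set1.
- by move=> w; rewrite fine_ge0.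
Qed.

Lemma retention2E u r1 r2 :
  retention2 P favor_small_kernel Phi u r1 r2 =
  retention2_w P Phi u r1 (inverse_radius r1) r2 (inverse_radius r2).
Proof.
rewrite /retention2 (@ge0_Rintegral_dirac _ _ _ (inverse_radius r1)).
- rewrite (@ge0_Rintegral_dirac _ _ _ (inverse_radius r2))// => w.
  by rewrite fine_ge0.
- exact: emeasurable_set1.
- by move=> w; apply: Rintegral_ge0 => // w' _; rewrite fine_ge0.
Qed.

Lemma retention_ge0 r : 0 <= retention P favor_small_kernel Phi r.
Proof. by rewrite retentionE void_prob_ge0. Qed.

Lemma retention_le1 r : retention P favor_small_kernel Phi r <= 1.
Proof.
rewrite retentionE -lee_fin -P_voidE; last exact: measurable_killers.
apply: probability_le1; apply: (measurable_void poisson).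
exact: measurable_killers.
Qed.

Lemma retention_le r t : 0 < t -> t <= r ->
  retention P favor_small_kernel Phi r <=
  expR (- (lambda * unit_ball_volume d * t ^+ d * fine (F `[0, t[%classic))).
Proof. by rewrite retentionE; exact: void_prob_killers_le. Qed.

Let q := retention_cov P favor_small_kernel Phi.

Lemma retention2_bounds u r1 r2 :
  let h2 := retention2 P favor_small_kernel Phi u r1 r2 in
  [/\ 0 <= h2, h2 <= retention P favor_small_kernel Phi r1 &
      h2 <= retention P favor_small_kernel Phi r2].
Proof.
rewrite /= retention2E !retentionE /retention2_w.
set g1 : grain R d := (origin d, r1, _); set g2 : grain R d := (on_axis d u, r2, _).
have [[g12 s12 s21]|h] := pselect [/\ g1 <> g2, survives g1 g2 & survives g2 g1]; last first.
  by rewrite (retained2_incompatible _ h) measure0 /=; split => //; exact: void_prob_ge0.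
rewrite (retained2E Phi_nonneg g12 s12 s21) -voidU -/(void_prob _).
have m1 := measurable_killers g1; have m2 := measurable_killers g2.
have m12 : measurable (killers g1 `|` killers g2) by exact: measurableU.
split; first exact: void_prob_ge0.
  by apply: void_prob_le => // g; left.
rewrite -(void_prob_reference (on_axis d u)).
by apply: void_prob_le => // g; right.
Qed.

(** Two small reference grains that are far apart have disjoint sets of
    killers on the support of the intensity: a killer meets its victim and is
    not larger. *)
Lemma retention_cov_far (u r1 r2 t : R) : (0 < d)%N ->
  r1 <= t -> r2 <= t -> 0 < u -> 4 * t < u -> q u r1 r2 = 0.
Proof.
move=> d0 r1t r2t u0 tu; rewrite /q /retention_cov retention2E !retentionE /retention2_w.
rewrite -[X in _ - _ * X](void_prob_reference (on_axis d u)).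
rewrite -!/(reference _ _).
set g1 := reference (origin d) r1; set g2 := reference (on_axis d u) r2.
have u12 : edist (center g1) (center g2) = u.
  by rewrite -enormE enorm_on_axis// gtr0_norm.
have far (g g' : grain R d) : body g' `&` body g !=set0 ->
    edist (center g) (center g') <= radius g + radius g'.
  move=> [y [g'y gy]]; apply: le_trans (edist_triangle _ y _) _.
  by rewrite lerD// edistC.
have t_gt : radius g1 + radius g2 < u.
  by rewrite /g1 /g2 /radius /=; lra.
have g12 : g1 <> g2.
  by move=> e; move: u12; rewrite e edistxx => e0; rewrite -e0 ltxx in u0.
have s12 : survives g1 g2.
  by move=> /far; rewrite u12 leNgt t_gt.
have s21 : survives g2 g1.
  by move=> /far; rewrite edistC u12 addrC leNgt t_gt.
rewrite (retained2E Phi_nonneg g12 s12 s21) -voidU -/(void_prob _).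
have m1 := measurable_killers g1; have m2 := measurable_killers g2.
have mW := @measurable_off_diagonal R d.
rewrite -void_prob_diagonal; last exact: measurableU.
rewrite -(void_prob_diagonal m1) -(void_prob_diagonal m2) setDUl.
rewrite void_probU ?subrr//; [exact: measurableD|exact: measurableD|].
have small (g : grain R d) r : radius g = r -> weight g = inverse_radius r -> r <= t ->
    forall g', 0 <= radius g' -> ~ survives g g' -> weight g' = inverse_radius (radius g') ->
    edist (center g) (center g') <= 2 * t.
  move=> gr gw rt g' r'0 /not_implyP[meet nw] w'.
  have r0 : 0 <= r.
    by rewrite leNgt; apply/negP => r0; apply: nw; apply: survives_lt0 => //; rewrite gr.
  have r'r : radius g' <= r.
    by rewrite -inverse_radius_le// -gw -w' leNgt; exact/negP.
  by apply: le_trans (far _ _ meet) _; rewrite gr; lra.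
apply/seteqP; split => // g' [[[r'0 _ k1] /contrapT w'] [[_ _ k2] _]].
have := small g1 r1 erefl erefl r1t g' r'0 k1 w'.
have := small g2 r2 erefl erefl r2t g' r'0 k2 w'.
have := edist_triangle (center g1) (center g') (center g2).
rewrite u12 (edistC (center g') (center g2)); lra.
Qed.

(** If one radius exceeds [t], all terms of the covariance are at most the
    probability that this grain is retained. *)
Lemma retention_cov_le (u r1 r2 t : R) : (0 < d)%N -> 0 < t -> 4 * t < u ->
  `|q u r1 r2| <=
  expR (- (lambda * unit_ball_volume d * t ^+ d * fine (F `[0, t[%classic))).
Proof.
move=> d0 t0 tu; set E := expR _.
have [h2_ge0 h2_le1 h2_le2] := retention2_bounds u r1 r2.
have := retention_ge0 r1; have := retention_ge0 r2.
have := retention_le1 r1; have := retention_le1 r2.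
move: h2_ge0 h2_le1 h2_le2; rewrite /q /retention_cov.
set a := retention _ _ _ r1; set b := retention _ _ _ r2; set h := retention2 _ _ _ _ _ _.
move=> h0 ha hb b1 a1 b0 a0.
have [r1t|r1t] := leP r1 t; last first.
  have aE : a <= E by apply: retention_le => //; exact: ltW.
  by rewrite ler_norml; apply/andP; split; nra.
have [r2t|r2t] := leP r2 t; last first.
  have bE : b <= E by apply: retention_le => //; exact: ltW.
  by rewrite ler_norml; apply/andP; split; nra.
have := retention_cov_far d0 r1t r2t (lt_trans (mulr_gt0 (ltr0n _ 4) t0) tu) tu.
by rewrite /q /retention_cov -/a -/b -/h => ->; rewrite normr0 expR_ge0.
Qed.

End retention.

(** * Approximation of an event by an independent one *)

Section probability_inequalities.
Context {dO : measure_display} {Omega : measurableType dO} {R : realType}.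
Variable P : probability Omega R.
Implicit Types A B E X Y : set Omega.
Local Notation pr E := (fine (P E)).

Lemma pr_ge0 E : 0 <= pr E.
Proof. exact: fine_ge0. Qed.

Lemma pr_fine E : measurable E -> P E = (pr E)%:E.
Proof. by move=> mE; rewrite fineK// fin_num_measure. Qed.

Lemma pr_le1 E : measurable E -> pr E <= 1.
Proof. by move=> mE; rewrite -lee_fin -pr_fine// probability_le1. Qed.

Lemma le_pr A B : measurable A -> measurable B -> A `<=` B -> pr A <= pr B.
Proof.
move=> mA mB AB; rewrite -lee_fin -!pr_fine//.
by apply: le_measure; rewrite ?inE.
Qed.

Lemma pr_setU_le A B : measurable A -> measurable B -> pr (A `|` B) <= pr A + pr B.
Proof.
move=> mA mB; rewrite -lee_fin EFinD -!pr_fine//; last exact: measurableU.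
exact: measureU2.
Qed.

Lemma pr_bigcup_le (I : finType) (A : I -> set Omega) (e : R) :
  (forall i, measurable (A i)) -> (forall i, pr (A i) <= e) ->
  measurable (\bigcup_i A i) /\ pr (\bigcup_i A i) <= #|I|%:R * e.
Proof.
move=> mA Ae.
rewrite (_ : \bigcup_i A i = \big[setU/set0]_(i <- enum I) A i); last first.
  rewrite -bigcup_seq; apply/seteqP; split => omega [i _ Ai]; exists i => //=.
  by rewrite mem_enum.
rewrite cardE; elim: (enum I) => [|i s [ms IH]].
  by rewrite big_nil measure0 mul0r; split.
rewrite big_cons; split; first exact: measurableU.
apply: le_trans (pr_setU_le (mA i) ms) _ => /=.
by rewrite -natr1 mulrDl mul1r addrC lerD.
Qed.

Lemma pr_approx X E B : measurable X -> measurable E -> measurable B ->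
  (forall omega, ~ B omega -> X omega <-> E omega) -> `|pr X - pr E| <= pr B.
Proof.
move=> mX mE mB XE.
have half A A' : measurable A -> measurable A' ->
    (forall omega, ~ B omega -> A omega <-> A' omega) -> pr A <= pr A' + pr B.
  move=> mA mA' AA'; apply: le_trans (pr_setU_le mA' mB).
  apply: le_pr => //; first exact: measurableU.
  move=> omega Ao; have [Bo|Bo] := pselect (B omega); first by right.
  by left; apply/AA'.
have h1 := half X E mX mE XE.
have h2 : pr E <= pr X + pr B by apply: half => // omega Bo; apply: iff_sym; exact: XE.
by rewrite ler_norml; apply/andP; split; lra.
Qed.

(** The joint probability and the product of the probabilities are each
    perturbed by at most [pr B + pr B']. *)
Lemma pr_cov_approx X Y E E' B B' :
  measurable X -> measurable Y -> measurable E -> measurable E' ->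
  measurable B -> measurable B' ->
  (forall omega, ~ B omega -> X omega <-> E omega) ->
  (forall omega, ~ B' omega -> Y omega <-> E' omega) ->
  P (E `&` E') = (P E * P E')%E ->
  `|pr (X `&` Y) - pr X * pr Y| <= 2 * (pr B + pr B').
Proof.
move=> mX mY mE mE' mB mB' XE YE' EE'.
have indep : pr (E `&` E') = pr E * pr E'.
  by apply: EFin_inj; rewrite EFinM -!pr_fine//; exact: measurableI.
have hX := pr_approx mX mE mB XE; have hY := pr_approx mY mE' mB' YE'.
have hXY : `|pr (X `&` Y) - pr (E `&` E')| <= pr B + pr B'.
  apply: le_trans (pr_setU_le mB mB').
  apply: pr_approx; [exact: measurableI|exact: measurableI|exact: measurableU|].
  by move=> omega /not_orP[Bo Bo'] /=; rewrite XE// YE'.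
move: hXY hX hY; rewrite indep !ler_norml.
have := pr_ge0 X; have := pr_ge0 Y; have := pr_ge0 E; have := pr_ge0 E'.
have := pr_le1 mX; have := pr_le1 mY; have := pr_le1 mE; have := pr_le1 mE'.
move: (pr (X `&` Y)) (pr X) (pr Y) (pr E) (pr E') (pr B) (pr B').
move=> xy x y e e' b b' e'1 e1 y1 x1 e'0 e0 y0 x0 /andP[? ?] /andP[? ?] /andP[? ?].
by apply/andP; split; nra.
Qed.

End probability_inequalities.

(** * The cover by retained grains *)

Section cover.
Context {R : realType} {d : nat} {dO : measure_display} {Omega : measurableType dO}.
Variables (P : probability Omega R) (lambda : R) (F : probability R R)
  (Phi : Omega -> set (grain R d)).
Hypothesis hPhi : is_grain_process P lambda F favor_small_kernel Phi.

Let poisson := grain_poisson hPhi.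

Let Phi_nonneg omega g (Pg : Phi omega g) : 0 <= radius g :=
  (grain_nonneg hPhi Pg).1.

(** Separating the candidates [A] from the competitors [V] localizes the
    retention of grains: for [A] inside [V], only the grains in [V] matter. *)
Definition survivor (A V : set (grain R d)) : set Omega :=
  [set omega | exists g, [/\ Phi omega g, A g &
    forall g', Phi omega g' -> V g' -> g' <> g -> survives g g']].

Definition centered_within (z : d.-tuple R) (rho : R) : set (grain R d) :=
  [set g | edist z (center g) <= rho].

Lemma measurable_centered_within z rho : measurable (centered_within z rho).
Proof.
rewrite -[X in measurable X]setTI; apply: measurable_fun_le => //.
exact: measurable_edist_center.
Qed.

Lemma finite_centered_within z rho omega :
  finite_set (Phi omega `&` centered_within z rho).
Proof.
apply: sub_finite_set (grain_locally_finite hPhi omega (edist (origin d) z + rho)).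
move=> g [Pg zg]; split => //=; rewrite enormE.
by apply: le_trans (edist_triangle _ z _) _; rewrite lerD2l.
Qed.

Lemma g_survivor_grain A V z rho : measurable A -> measurable V ->
  A `<=` V -> V `<=` centered_within z rho ->
  <<s void_sets Phi V >> (survivor A V).
Proof.
move=> mA mV AV Vz.
have finV omega : finite_set (Phi omega `&` V).
  by apply: sub_finite_set (finite_centered_within z rho omega) => g [? /Vz].
have := g_survivor rectangular_grain_neq rectangular_spares mV finV mA AV.
congr (<<s _ >> _); apply/seteqP; split => omega /= [g [Pg Ag h]];
  exists g; split => // g' Pg' Vg' gg'.
  by apply/survivesP; [exact: Phi_nonneg Pg|exact: Phi_nonneg Pg'|exact: h].
by apply/survivesP; [exact: Phi_nonneg Pg|exact: Phi_nonneg Pg'|exact: h].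
Qed.

Lemma measurable_survivor A V z rho : measurable A -> measurable V ->
  A `<=` V -> V `<=` centered_within z rho -> measurable (survivor A V).
Proof.
move=> mA mV AV Vz; have := g_survivor_grain mA mV AV Vz.
apply: smallest_sub; first exact: sigma_algebra_measurable.
by move=> _ [B [mB _ ->]]; exact: (measurable_void poisson).
Qed.

Definition covering (z : d.-tuple R) : set (grain R d) :=
  [set g | edist z (center g) <= radius g].

Lemma measurable_covering z : measurable (covering z).
Proof.
rewrite -[X in measurable X]setTI; apply: measurable_fun_le => //.
  exact: measurable_edist_center.
exact: measurable_radius.
Qed.

Lemma X_thE z : [set omega | X_th Phi omega z] = survivor (covering z) setT.
Proof.
apply/seteqP; split => omega /= [g].
  move=> [Pg h] zg; exists g; split => //; first by rewrite /covering /= edistC.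
  by move=> g' Pg' _ gg'; exact: h.
move=> [Pg zg h]; exists g; last by move: zg; rewrite /covering /= edistC.
by split => // g' Pg' gg'; exact: h.
Qed.

(** Radii being unbounded, grains arbitrarily far away may remove a grain that
    covers [z].  But the grains that cover [z] and are centered in a given ball
    are finitely many: if each of them is removed, then a sufficiently large
    window contains killers for all of them.  So the cover event is a countable
    combination of survivor events in bounded windows. *)
Lemma measurable_X_th z : measurable [set omega | X_th Phi omega z].
Proof.
pose W n := centered_within z n%:R.
have WS m n : (m <= n)%N -> W m `<=` W n.
  by move=> mn g /= h; apply: le_trans h _; rewrite ler_nat.
rewrite X_thE (_ : survivor _ _ =
    \bigcup_m \bigcap_n survivor (covering z `&` W m) (W (m + n)%N)).
  apply: bigcupT_measurable => m; apply: bigcapT_measurable => n.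
  apply: (@measurable_survivor _ _ z (m + n)%:R) => //.
  - by apply: measurableI; [exact: measurable_covering|exact: measurable_centered_within].
  - exact: measurable_centered_within.
  - by move=> g [_]; apply: WS; exact: leq_addr.
apply/seteqP; split => omega /=.
  move=> [g [Pg zg h]]; have z0 : 0 <= edist z (center g) by exact: edist_ge0.
  have /andP[_ lt] := truncn_itv z0.
  exists (Num.truncn (edist z (center g))).+1 => // n _; exists g; split => //.
    by split => //; exact: ltW.
  by move=> g' Pg' _; exact: h.
move=> [m _ h]; apply: contrapT => none.
have /choice[n nP] : forall g, exists n, Phi omega g -> covering z g ->
    exists g', [/\ Phi omega g', W (m + n)%N g', g' <> g & ~ survives g g'].
  move=> g; have [Pg|nPg] := pselect (Phi omega g); last by exists 0%N.
  have [zg|nzg] := pselect (covering z g); last by exists 0%N.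
  have [g' [Pg' gg' s]] : exists g', [/\ Phi omega g', g' <> g & ~ survives g g'].
    apply: contrapT => nog'; apply: none; exists g; split => // g' Pg' _ gg'.
    by apply: contrapT => s; apply: nog'; exists g'.
  have z0 : 0 <= edist z (center g') by exact: edist_ge0.
  have /andP[_ lt] := truncn_itv z0.
  exists (Num.truncn (edist z (center g'))).+1 => _ _; exists g'; split => //.
  by apply: le_trans (ltW lt) _; rewrite ler_nat leq_addl.
have /finite_seqP[s sE] := finite_centered_within z m%:R omega.
have [g [Pg [zg Wg] h']] := h (\max_(g <- s) n g)%N Logic.I.
have [g' [Pg' Wg' gg' s']] := nP g Pg zg.
apply: s'; apply: h' => //; move: Wg'; apply: WS; rewrite leq_add2l.
apply: (@leq_bigmax_seq _ s xpredT n g) => //.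
by have : [set` s] g by rewrite -sE.
Qed.

End cover.

(** * Decorrelation of the cover *)

Section decorrelation.
Context {R : realType} {d : nat} {dO : measure_display} {Omega : measurableType dO}.
Variables (P : probability Omega R) (lambda : R) (F : probability R R)
  (Phi : Omega -> set (grain R d)).
Hypothesis hPhi : is_grain_process P lambda F favor_small_kernel Phi.

Let poisson := grain_poisson hPhi.

Let Phi_nonneg omega g (Pg : Phi omega g) : 0 <= radius g :=
  (grain_nonneg hPhi Pg).1.

Definition small_covering (z : d.-tuple R) (t : R) : set (grain R d) :=
  covering z `&` [set g | radius g <= t].

Definition small_near (z : d.-tuple R) (t : R) : set (grain R d) :=
  centered_within z (3 * t) `&` [set g | radius g <= t].

(** Killers are not larger than their victims: those of a grain that covers [z]
    with radius at most [t] are centered within [3 * t] of [z], since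
    [|z - x'| <= |z - x| + r + r']. *)
Definition locally_covered (z : d.-tuple R) (t : R) : set Omega :=
  survivor Phi (small_covering z t) (small_near z t).

Lemma measurable_small t : measurable [set g : grain R d | radius g <= t].
Proof.
rewrite -[X in measurable X]setTI; apply: measurable_fun_le => //.
exact: measurable_radius.
Qed.

Lemma g_locally_covered z t : 0 <= t ->
  <<s void_sets Phi (small_near z t) >> (locally_covered z t).
Proof.
move=> t0; apply: (g_survivor_grain hPhi (z := z) (rho := 3 * t)).
- by apply: measurableI; [exact: measurable_covering|exact: measurable_small].
- by apply: measurableI; [exact: measurable_centered_within|exact: measurable_small].
- move=> g [zg gt]; split => //; apply: le_trans zg _; apply: le_trans gt _; lra.
- by move=> g [].
Qed.

Section bad_event.
Variables (I : finType) (p : I -> d.-tuple R).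
Hypothesis p_net : forall x, edist (origin d) x <= 1 ->
  exists j, edist (p j) x <= 1 / 2.

(** The grains of each of these boxes remove every grain of radius larger than
    [t] that contains the ball of the box. *)
Definition unblocked (z : d.-tuple R) (t : R) : set Omega :=
  \bigcup_j void Phi (box (affine z t (p j)) (t / 2) t).

Definition bad (z : d.-tuple R) (t : R) : set Omega :=
  ~` void Phi off_diagonal `|` unblocked z t.

Lemma bad_prob_le z t : 0 < t ->
  measurable (bad z t) /\ fine (P (bad z t)) <= #|I|%:R *
    expR (- (lambda * unit_ball_volume d * (t / 2) ^+ d * fine (F `[0, t[%classic))).
Proof.
move=> t0; have t20 : 0 < t / 2 by rewrite divr_gt0.
have mo : measurable (void Phi (@off_diagonal R d)).
  by apply: (measurable_void poisson); exact: measurable_off_diagonal.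
have [mu pu] : measurable (unblocked z t) /\ fine (P (unblocked z t)) <= #|I|%:R *
    expR (- (lambda * unit_ball_volume d * (t / 2) ^+ d * fine (F `[0, t[%classic))).
  apply: pr_bigcup_le => j.
    by apply: (measurable_void poisson); exact: measurable_box.
  by rewrite -[leLHS]/(void_prob P Phi _) (void_prob_box hPhi).
split; first by apply: measurableU => //; exact: measurableC.
apply: le_trans (pr_setU_le P (measurableC mo) mu) _.
rewrite -[leRHS]add0r lerD// probability_setC//.
rewrite (null_void poisson) ?subee//; first exact: measurable_off_diagonal.
exact: intensity_off_diagonal.
Qed.

(** A retained grain that contains [z] and has a radius larger than [t] contains
    a ball of radius [t] around which [z] lies, hence one of the net balls of
    radius [t / 2]; no grain smaller than [t] can then be centered there. *)
Lemma locally_coveredP z t omega : 0 < t -> ~ bad z t omega ->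
  X_th Phi omega z <-> locally_covered z t omega.
Proof.
move=> t0 /not_orP[/contrapT diag nbad].
have weightE g : Phi omega g -> weight g = inverse_radius (radius g).
  by move=> Pg; apply: contrapT; exact: (void_notin diag Pg).
split; last first.
  move=> [g [Pg [zg gt] h]]; exists g; last by move: zg; rewrite /covering /= edistC.
  split => // g' Pg' gg' meet; rewrite ltNge; apply/negP => w.
  have r'r : radius g' <= radius g.
    by rewrite -inverse_radius_le ?(Phi_nonneg Pg) ?(Phi_nonneg Pg')// -!weightE.
  suff Vg' : small_near z t g' by move: (h g' Pg' Vg' gg' meet); rewrite ltNge w.
  split; last exact: le_trans r'r gt.
  have [y [g'y gy]] := meet; rewrite /centered_within /=.
  have := edist_triangle z (center g) (center g').
  have := edist_triangle (center g) y (center g').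
  move: g'y gy zg gt r'r; rewrite /body /cball /covering /= (edistC y); lra.
move=> [g [Pg h] zg]; set s := radius g.
have {}zg : edist z (center g) <= s by move: zg; rewrite /body /cball /= edistC.
have [st|ts] := leP s t.
  by exists g; split => // g' Pg' _ gg'; exact: h.
have s0 : 0 < s by exact: lt_trans ts.
exfalso; apply: nbad.
pose y : d.-tuple R := [tuple (tnth (center g) i - tnth z i) / s | i < d].
have yE : center g = affine z s y.
  by apply/eq_from_tnth => i; rewrite !tnth_mktuple; field; rewrite gt_eqF.
have y1 : edist (origin d) y <= 1.
  rewrite -(ler_pM2l s0) mulr1 -(edist_affine z _ _ (ltW s0)) affine_origin -yE.
  exact: zg.
have [j jy] := p_net y1; exists j => //; apply: contrapT => /not_void[g' [Pg' [cg' r't w']]].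
have ty : edist (affine z t (p j)) (affine z t y) <= t * (1 / 2).
  by rewrite edist_affine ?(ltW t0)// ler_pM2l.
have sty : edist (affine z t y) (center g) <= s - t.
  have -> : edist (affine z t y) (center g) = (s - t) * edist (origin d) y.
    have st0 : 0 <= s - t by rewrite subr_ge0 ltW.
    rewrite -(edist_affine (affine z t y) _ _ st0) affine_origin yE; congr edist.
    by apply/eq_from_tnth => i; rewrite !tnth_mktuple; ring.
  by rewrite -[leRHS]mulr1 ler_wpM2l// subr_ge0 ltW.
have gg' : edist (center g) (center g') <= s.
  have := edist_triangle (center g) (affine z t y) (center g').
  have := edist_triangle (affine z t y) (affine z t (p j)) (center g').
  move: cg' ty sty; rewrite /cball /= (edistC (center g) (affine z t y)) (edistC (affine z t y) (affine z t (p j))).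
  lra.
have /andP[r'0 {}r't] := r't.
have neq : g' <> g by move=> e; move: r't; rewrite e -/s ltNge (ltW ts).
have := h g' Pg' neq.
have meet : body g' `&` body g !=set0.
  by exists (center g'); split; rewrite /body /cball /= ?edistxx.
move=> /(_ meet); rewrite ltNge (weightE _ Pg) (le_trans _ w')//.
by rewrite inverse_radius_le ?(ltW t0) ?(ltW s0)// ltW.
Qed.

End bad_event.

(** Replacing, at two distant points, the cover by its local version makes the
    two events depend on the grains in disjoint windows. *)
Lemma k_th_le : exists N : nat, forall (z : d.-tuple R) (t : R),
  0 < t -> 6 * t < enorm z ->
  `|k_th P Phi z| <= N%:R *
    expR (- (lambda * unit_ball_volume d * (t / 2) ^+ d * fine (F `[0, t[%classic))).
Proof.
have [I [p p_net]] := @unit_ball_net R d.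
exists (4 * #|I|)%N => z t t0 tz.
have [mb bl] := bad_prob_le p (origin d) t0.
have [mb' bl'] := bad_prob_le p z t0.
have disj : small_near (origin d) t `&` small_near z t = set0.
  apply/seteqP; split => // g [[og _] [zg _]].
  have := edist_triangle (origin d) (center g) z.
  move: tz og zg; rewrite enormE /centered_within /= (edistC (center g)); lra.
have [mE mE' EE'] := independent_windows poisson disj
  (g_locally_covered (z := origin d) (ltW t0)) (g_locally_covered (z := z) (ltW t0)).
rewrite /k_th natrM -mulrA.
have := pr_cov_approx (measurable_X_th hPhi (origin d)) (measurable_X_th hPhi z)
  mE mE' mb mb' (fun omega => locally_coveredP p_net t0)
  (fun omega => locally_coveredP p_net t0) EE'.
move=> /le_trans; apply; move: bl bl'; set B := _ * expR _; lra.
Qed.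

End decorrelation.

(** * Exponential decay *)

(** For large [t], at least half of the grains are smaller than [t]: this is the
    origin of the factor 1/2 in the exponents. *)
Lemma half_mass (R : realType) (F : probability R R) :
  F `[0, +oo[%classic = 1%E ->
  exists2 T : R, 0 < T & forall t, T <= t -> 1 / 2 <= fine (F `[0, t[%classic).
Proof.
move=> hF; pose I (n : nat) : set R := `[0, n%:R[%classic.
have mI n : measurable (I n) by exact: measurable_itv.
have UI : \bigcup_n I n = `[0, +oo[%classic.
  apply/seteqP; split => [x [n _]|x]; rewrite /I /= !in_itv /=.
    by move=> /andP[->].
  rewrite andbT => x0; have /andP[_ lt] := truncn_itv x0.
  by exists (Num.truncn x).+1; rewrite //= in_itv /= x0.
have cvgI : (F \o I) n @[n --> \oo] --> 1%E.
  rewrite -hF -UI; apply: nondecreasing_cvg_mu => //.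
    by rewrite UI; exact: measurable_itv.
  move=> m n mn; apply/subsetPset => x; rewrite /I /= !in_itv /= => /andP[-> xm].
  by rewrite (lt_le_trans xm)// ler_nat.
have /fine_cvgP[_ cvgf] := cvgI.
have [n _ /(_ n (leqnn n)) hn] : \forall n \near \oo, 1 / 2 < fine (F (I n)).
  by apply: (cvgr_gt 1 cvgf); lra.
exists n.+1%:R => [|t nt]; first by rewrite ltr0n.
apply: (le_trans (ltW hn)); rewrite fine_le ?fin_num_measure//; try exact: measurable_itv.
apply: le_measure; rewrite ?inE //; try exact: measurable_itv.
move=> x; rewrite /I /= !in_itv /= => /andP[-> xn].
by apply: lt_le_trans xn _; apply: le_trans nt; rewrite ler_nat.
Qed.

Lemma absorb_factor (R : realType) (A y : R) : A <= y -> A * expR (- (2 * y)) <= expR (- y).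
Proof.
move=> Ay; rewrite (_ : - (2 * y) = - y + - y); last by ring.
rewrite expRD mulrA ler_piMl ?expR_ge0// expRN ler_pdivrMr ?expR_gt0// mul1r.
by apply: le_trans Ay _; apply: le_trans (expR_ge1Dx y); rewrite lerDr.
Qed.

Section decay.
Context {R : realType} {d : nat} {dO : measure_display} {Omega : measurableType dO}.
Variables (P : probability Omega R) (lambda : R) (F : probability R R)
  (Phi : Omega -> set (grain R d)).
Hypotheses (d_gt0 : (0 < d)%N) (lambda_gt0 : 0 < lambda).
Hypothesis hPhi : is_grain_process P lambda F favor_small_kernel Phi.

Let b := lambda * unit_ball_volume d.
Let b_gt0 : 0 < b. Proof. by rewrite mulr_gt0// unit_ball_volume_gt0. Qed.

Lemma Fbar_th_le (r : R) : 0 < r -> 1 / 2 <= fine (F `[0, r[%classic) ->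
  Fbar_th P lambda F favor_small_kernel Phi r <=
  lambda / lambda_th P lambda F favor_small_kernel Phi * expR (- (b * (1 / 2) * r ^+ d)).
Proof.
move=> r0 hr; rewrite /Fbar_th /F_th opprB addrC subrK.
have lth : 0 <= lambda / lambda_th P lambda F favor_small_kernel Phi.
  apply: divr_ge0; first exact: ltW.
  apply: mulr_ge0; first exact: ltW.
  by apply: Rintegral_ge0 => // s _; exact: (retention_ge0 hPhi).
apply: ler_wpM2l => //; apply: le_trans (ler_norm _) _.
apply: normr_Rintegral_le; [exact: measurable_itv|exact: expR_ge0|].
move=> s /=; rewrite in_itv /= andbT => rs.
rewrite ger0_norm ?(retention_ge0 hPhi)//.
apply: le_trans (retention_le hPhi r0 (ltW rs)) _.
rewrite ler_expR lerN2 -/b [leLHS]mulrAC; apply: ler_wpM2l => //.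
by apply: mulr_ge0; [exact: ltW|apply: exprn_ge0; exact: ltW].
Qed.

Lemma xi_th_le (z : d.-tuple R) (t : R) : 0 < t -> 4 * t < enorm z ->
  `|xi_th P lambda F favor_small_kernel Phi z| <=
  lambda ^+ 2 / lambda_th P lambda F favor_small_kernel Phi ^+ 2 *
  expR (- (b * t ^+ d * fine (F `[0, t[%classic))).
Proof.
move=> t0 tz; rewrite /xi_th normrM ger0_norm ?divr_ge0 ?sqr_ge0//.
rewrite ler_wpM2l ?divr_ge0 ?sqr_ge0//.
apply: normr_Rintegral_le; [exact: measurableT|exact: expR_ge0|move=> r1 _].
apply: normr_Rintegral_le; [exact: measurableT|exact: expR_ge0|].
by move=> r2 _; exact: (retention_cov_le hPhi).
Qed.

End decay.

Theorem theorem8p1 (R : realType) (d : nat) (hd : (0 < d)%N)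
    (lambda : R) (hlambda : 0 < lambda)
    (F : probability R R) (hF : F `[0, +oo[%classic = 1%E)
    (hFd : (\int[F]_(r in `[0%R, +oo[) (r ^+ d)%:E < +oo)%E)
    (dO : measure_display) (Omega : measurableType dO)
    (P : probability Omega R) (Phi : Omega -> set (grain R d))
    (hPhi : is_grain_process P lambda F favor_small_kernel Phi) :
  exists c : R, 0 < c /\
    exists r0 rho0 : R, forall (r : R) (z : d.-tuple R),
      r0 <= r -> rho0 <= enorm z ->
      [/\ Fbar_th P lambda F favor_small_kernel Phi r <=
            lambda / lambda_th P lambda F favor_small_kernel Phi *
            expR (- (lambda * unit_ball_volume d * (1 / 2) * r ^+ d)),
          `|k_th P Phi z| <=
            expR (- (lambda * unit_ball_volume d * c * enorm z ^+ d)) &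
          `|xi_th P lambda F favor_small_kernel Phi z| <=
            expR (- (lambda * unit_ball_volume d * c * enorm z ^+ d))].
Proof.
have [T T0 hT] := half_mass hF.
have [N kN] := k_th_le hPhi.
pose M := lambda ^+ 2 / lambda_th P lambda F favor_small_kernel Phi ^+ 2.
have M0 : 0 <= M by rewrite divr_ge0// sqr_ge0.
pose b := lambda * unit_ball_volume d.
have b0 : 0 < b by rewrite mulr_gt0// unit_ball_volume_gt0.
(* Truncating at [t = |z| / 7] and using net balls of radius [t / 2] gives the
   exponent [b (|z| / 14) ^ d / 2]; one half of it is kept. *)
pose c : R := (4 * 14 ^+ d)^-1.
have c0 : 0 < c by rewrite invr_gt0 mulr_gt0// exprn_gt0.
have bc0 : 0 < b * c by exact: mulr_gt0.
(* Beyond the last bound on [|z|], [b c |z| ^ d] exceeds the constant factors. *)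
exists c; split => //; exists T, (Num.max (Num.max 1 (7 * T)) ((N%:R + M) / (b * c))).
move=> r z Tr; rewrite !ge_max -andbA => /and3P[z1 zT zA].
set u := enorm z in z1 zT zA *.
pose t := u / 7.
have uE : u = 7 * t by rewrite /t; field.
have u0 : 0 < u by exact: lt_le_trans z1.
have t0 : 0 < t by rewrite divr_gt0.
have Tt : T <= t by rewrite -(ler_pM2l (ltr0n _ 7)) -uE.
pose y := b * c * u ^+ d.
have Ay : N%:R + M <= y.
  rewrite ler_pdivrMr// mulrC in zA; apply: le_trans zA _.
  rewrite ler_pM2l// -[leLHS]expr1; exact: ler_weXn2l.
have half_t := hT t Tt.
have small_exp : 2 * y <= b * (t / 2) ^+ d * fine (F `[0, t[%classic).
  rewrite (_ : 2 * y = b * (t / 2) ^+ d * (1 / 2)).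
    by rewrite ler_wpM2l// mulr_ge0 ?(ltW b0)// exprn_ge0// divr_ge0// ltW.
  rewrite /y /c uE; have -> : 7 * t = 14 * (t / 2) by field.
  by rewrite exprMn; field; rewrite expf_neq0.
have bound (A x : R) : 0 <= A -> A <= N%:R + M -> 2 * y <= x -> A * expR (- x) <= expR (- y).
  move=> A0 AM yx; apply: le_trans (absorb_factor (le_trans AM Ay)).
  by rewrite ler_wpM2l// ler_expR lerN2.
rewrite -/b -/y; split.
- by apply: Fbar_th_le => //; [exact: lt_le_trans Tr|exact: hT].
- apply: le_trans (kN z t t0 _) _; first by rewrite -/u uE ltr_pM2r// ltr_nat.
  by apply: bound => //; rewrite lerDl.
- apply: le_trans (xi_th_le hd hPhi t0 _) _; first by rewrite -/u uE ltr_pM2r// ltr_nat.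
  apply: bound => //; first by rewrite lerDr.
  apply: le_trans small_exp _; rewrite ler_wpM2r ?fine_ge0// ler_pM2l//.
  by apply: lerXn2r; rewrite ?nnegrE; lra.
Qed.
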